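(* For every $p\in(0,1)$ there exists $\alpha=\alpha(p)\in(1/2,1)$ such that $$\frac{\log \mathrm{LIS}(T_n)}{\log n}\xrightarrow[n\to\infty]{\mathbb P}\alpha,\qquad\text{and moreover}\qquad \alpha=\limsup_{n\to\infty}\frac{\log\mathbb E[\mathrm{LIS}(T_n)]}{\log n}.$$
   Context: A sign-decorated binary tree is a finite planar rooted tree in which every internal vertex (node) has exactly two ordered children and carries a sign $\oplus$ or $\ominus$; its size is its number of leaves. For a set $\mathcal L$ of leaves of $t$, the subtree $t|_{\mathcal L}$ is obtained by deleting all vertices with no descendant in $\mathcal L$ and contracting vertices with one child; signs are inherited. A subtree is positive if all its nodes carry $\oplus$. $\mathrm{LIS}(t)$ is the maximal number of leaves of a positive subtree of $t$. Fix $p\in(0,1)$. $T_n$ denotes a uniform planar rooted binary tree with $n$ leaves whose nodes carry i.i.d. signs with $\mathbb P(\oplus)=p$. *)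

(* Defs.v *)
From HB Require Import structures.
From mathcomp Require Import all_boot all_order all_algebra.
From mathcomp Require Import all_classical all_reals all_analysis.
Set Implicit Arguments. Unset Strict Implicit. Unset Printing Implicit Defensive.
Import Order.TTheory GRing.Theory Num.Theory.

(* Sign-decorated planar rooted binary trees: [Node s l r] is an internal
   vertex with sign s (true = ⊕, false = ⊖), left child l, right child r. *)
Inductive stree : Type :=
  | Leaf : stree
  | Node : bool -> stree -> stree -> stree.

Fixpoint leaves (t : stree) : nat :=
  match t with Leaf => 1 | Node _ l r => leaves l + leaves r end.

(* A set of leaves of t is encoded as a bit mask over the leaves of t,
   listed from left to right.  [restrict t m] is the subtree t|_L
   (None when L is empty): vertices with no descendant in L are deleted
   and vertices left with one child are contracted; signs are inherited. *)
Fixpoint restrict (t : stree) (m : seq bool) : option stree :=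
  match t with
  | Leaf => if head false m then Some Leaf else None
  | Node s l r =>
      match restrict l (take (leaves l) m), restrict r (drop (leaves l) m) with
      | Some a, Some b => Some (Node s a b)
      | Some a, None => Some a
      | None, Some b => Some b
      | None, None => None
      end
  end.

Fixpoint positive (t : stree) : bool :=
  match t with Leaf => true | Node s l r => [&& s, positive l & positive r] end.

Definition positive_restr (t : stree) (m : seq bool) : bool :=
  if restrict t m is Some u then positive u else false.

Definition LIS (t : stree) : nat :=
  \max_(m : (leaves t).-tuple bool | positive_restr t m) count id m.

Fixpoint nplus (t : stree) : nat :=
  match t with Leaf => 0 | Node s l r => s + nplus l + nplus r end.
Fixpoint nminus (t : stree) : nat :=
  match t with Leaf => 0 | Node s l r => (~~ s) + nminus l + nminus r end.

(* all sign-decorated trees of depth <= d (without repetition) *)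
Fixpoint trees_depth (d : nat) : seq stree :=
  match d with
  | 0 => [:: Leaf]
  | d'.+1 => Leaf :: flatten [seq [seq Node s l r | l <- trees_depth d', r <- trees_depth d']
                        | s <- [:: true; false]]
  end.

(* all sign-decorated trees with n leaves (their depth is < n) *)
Definition trees_of (n : nat) : seq stree :=
  [seq t <- trees_depth n | leaves t == n].

Section Law.
Variable R : realType.
Local Open Scope ring_scope.

(* weight of a decorated tree: i.i.d. signs with P(⊕) = p *)
Definition sweight (p : R) (t : stree) : R :=
  p ^+ nplus t * (1 - p) ^+ nminus t.

(* Law of T_n: uniform shape with n leaves, i.i.d. signs.  Since the
   weights of the decorations of a fixed shape sum to 1, normalizing by the
   total weight (= number of shapes) gives exactly this law. *)
Definition ProbT (p : R) (n : nat) (A : stree -> bool) : R :=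
  (\sum_(t <- trees_of n | A t) sweight p t) / (\sum_(t <- trees_of n) sweight p t).

Definition ExpT (p : R) (n : nat) (X : stree -> R) : R :=
  (\sum_(t <- trees_of n) sweight p t * X t) / (\sum_(t <- trees_of n) sweight p t).
End Law.

(* Main.v *)
Require Import Defs.
From HB Require Import structures.
From mathcomp Require Import all_boot all_order all_algebra.
From mathcomp Require Import all_classical all_reals all_analysis.
From mathcomp Require Import zify ring lra.
Set Implicit Arguments. Unset Strict Implicit. Unset Printing Implicit Defensive.
Import Order.TTheory GRing.Theory Num.Theory.
Local Open Scope ring_scope.

(** The recursion [LIS (Node + l r) = LIS l + LIS r],
    [LIS (Node - l r) = max (LIS l) (LIS r)] is combined with generating functions
    for which the sums over trees are convolutions.  Let [f n] be the mean of
    [LIS T_n].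
    - A minimal subtree with at least [2a] leaves has a child with at least [a]
      leaves, and given their number the tree spanned by these minimal subtrees is
      again a uniform signed tree.  Hence [f n >= f k * f a / 256] for
      [n >= 512 a k], and Fekete's argument gives [alpha] with [f n <= B n^alpha]
      and [f n >= c n^(alpha - eps)].
    - [alpha > 1/2]: averaging over a leaf the [LIS] of the subtrees that hang
      from its [+] ancestors gives [n S_n >= (p/2) (S_1 + ... + S_(n-1))] for
      [S_n = 4^-n C_(n-1) f n], [C_k] being the Catalan numbers.
    - [alpha < 1]: only [+] vertices contribute cross terms to the second moment,
      which gains a factor [p] at every step of the recursion.
    - The same recursion bounds the second moment by [C n^(2 alpha)], so by
      Paley-Zygmund [LIS T_m >= f m / 2] with probability at least [m^(-2 eps)].
      [T_n] contains about [n / m] disjoint subtrees of size about [m]; for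
      [m = n^(1 - 3 eps)] one of them succeeds with high probability.  The upper
      bound on [LIS T_n] is Markov's inequality. *)

(** * Convolutions and rising factorials *)

(** Scaling by [4^-n] puts the singularity of the tree series at 1: the series C of [catalan] is (1
    - sqrt(1 - x)) / 2, hence 1 - 2C = sqrt(1 - x) and [cbin] is its inverse. A functional that is
    additive over the two children up to a source term has the series source / (1 - 2C). With
    sources (1 - x)^(-s) everything stays inside the family [rising], which convolution preserves;
    sums are therefore bounded by [rising s], and turned into powers n^(s + 1/2) only after division
    by [catalan]. The law of [LIS] grows with the size, since deleting a random leaf of a random
    tree gives a random tree. This carries estimates from one size a to all larger ones, and lets
    Fekete's argument work along powers of one integer. The obstacle in the skeleton argument is
    that a subtree conditioned to be minimal is no longer uniform. Once their sizes are fixed below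
    the threshold, however, its two children are uniform and independent, which is why a child of at
    least half the size is used, together with the mean at size a. *)

Section Convolution.
Variable R : comNzRingType.
Implicit Types (a b c : nat -> R) (n N : nat).

Definition conv a b n : R := \sum_(i < n.+1) a i * b (n - i)%N.

Definition trunc N a : {poly R} := \poly_(i < N.+1) a i.

Lemma coef_trunc N a n : (n <= N)%N -> (trunc N a)`_n = a n.
Proof. by move=> le_nN; rewrite coef_poly ltnS le_nN. Qed.

Lemma coef_trunc_mul N a b n :
  (n <= N)%N -> (trunc N a * trunc N b)`_n = conv a b n.
Proof.
move=> le_nN; rewrite coefM; apply: eq_bigr => i _.
by rewrite !coef_trunc//; have := ltn_ord i; lia.
Qed.

Lemma eq_coef_mulr (P Q S : {poly R}) N :
  (forall n, (n <= N)%N -> P`_n = Q`_n) ->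
  forall n, (n <= N)%N -> (S * P)`_n = (S * Q)`_n.
Proof.
move=> PQ n le_nN; rewrite !coefM; apply: eq_bigr => i _.
by rewrite PQ//; have := ltn_ord i; lia.
Qed.

Lemma eq_conv a a' b b' n :
  (forall i, (i <= n)%N -> a i = a' i) -> (forall i, (i <= n)%N -> b i = b' i) ->
  conv a b n = conv a' b' n.
Proof.
move=> aa' bb'; apply: eq_bigr => i _.
by rewrite aa' ?bb'//; have := ltn_ord i; lia.
Qed.

Lemma convC a b n : conv a b n = conv b a n.
Proof. by rewrite -!(@coef_trunc_mul n)// mulrC. Qed.

Lemma convA a b c n : conv a (conv b c) n = conv (conv a b) c n.
Proof.
transitivity ((trunc n a * (trunc n b * trunc n c))`_n).
  rewrite -(@coef_trunc_mul n)//; apply: (@eq_coef_mulr _ _ _ n) => // i ?.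
  by rewrite coef_trunc_mul// coef_trunc.
rewrite mulrA mulrC convC -(@coef_trunc_mul n)//.
apply: (@eq_coef_mulr _ _ _ n) => // i ?.
by rewrite coef_trunc_mul// coef_trunc.
Qed.

Lemma convDr a b c n :
  conv a (fun k => b k + c k) n = conv a b n + conv a c n.
Proof. by rewrite -big_split; apply: eq_bigr => i _; rewrite mulrDr. Qed.

Lemma convZr x a b n : conv a (fun k => x * b k) n = x * conv a b n.
Proof. by rewrite mulr_sumr; apply: eq_bigr => i _; rewrite mulrCA. Qed.

Lemma convZl x a b n : conv (fun k => x * a k) b n = x * conv a b n.
Proof. by rewrite mulr_sumr; apply: eq_bigr => i _; rewrite mulrA. Qed.

Definition delta (k n : nat) : R := (n == k)%:R.

Lemma conv_delta k a n :
  conv (delta k) a n = if (k <= n)%N then a (n - k)%N else 0.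
Proof.
case: leqP => [le_kn|lt_nk].
  rewrite /conv (bigD1 (inord k : 'I_n.+1))//= inordK// /delta eqxx mul1r.
  rewrite big1 ?addr0// => i /eqP ik; case: eqP => [iek|]; last by rewrite mul0r.
  by case: ik; apply: val_inj; rewrite /= inordK.
by apply: big1 => i _; rewrite /delta; case: eqP => [|_]; rewrite ?mul0r//; have := ltn_ord i; lia.
Qed.

Lemma sum_convE (F : nat -> nat -> R) N :
  \sum_(n < N) \sum_(i < n.+1) F i (n - i)%N
  = \sum_(i < N) \sum_(j < N | (i + j < N)%N) F i j.
Proof.
elim: N => [|N IH]; first by rewrite !big_ord0.
rewrite big_ord_recr IH /= [RHS]big_ord_recr /= [X in _ = _ + X](bigD1 ord0)/=; last by rewrite addn0.
rewrite [X in _ = _ + (_ + X)]big1; last first.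
  move=> j /andP[jN /eqP j0]; exfalso; apply: j0; apply: val_inj => /=; move: jN; lia.
rewrite addr0 big_ord_recr /= subnn addrA; congr (_ + _).
rewrite -big_split; apply: eq_bigr => i _ /=.
have iN := ltn_ord i.
rewrite (bigD1 (inord (N - i) : 'I_N.+1)) /= ?inordK; [|lia..].
rewrite addrC; congr (_ + _).
rewrite (big_ord_widen_cond N.+1 (fun j => (i + j < N)%N) (F i)) //.
apply: eq_bigl => j; apply/idP/idP => [/andP[H _]|/andP[H /eqP ne]].
  by apply/andP; split; [lia|apply/eqP => E; move: H; rewrite E inordK; lia].
have: nat_of_ord j <> (N - i)%N by move=> E; apply: ne; apply: val_inj; rewrite /= inordK; lia.
by move=> ?; lia.
Qed.

End Convolution.

Section Positivity.
Variable R : realFieldType.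
Implicit Types (a b c : nat -> R) (n N : nat).

Lemma conv_ge0 a b n : (forall i, 0 <= a i) -> (forall i, 0 <= b i) ->
  0 <= conv a b n.
Proof. by move=> a0 b0; apply: sumr_ge0 => i _; rewrite mulr_ge0. Qed.

Lemma ler_conv a b b' n : (forall i, 0 <= a i) ->
  (forall i, (i <= n)%N -> b i <= b' i) -> conv a b n <= conv a b' n.
Proof.
by move=> a0 bb'; apply: ler_sum => i _; rewrite ler_wpM2l// bb'//; lia.
Qed.

Lemma sum_conv_le a b N : (forall i, 0 <= a i) -> (forall i, 0 <= b i) ->
  \sum_(n < N) conv a b n <= (\sum_(i < N) a i) * (\sum_(j < N) b j).
Proof.
move=> a0 b0; rewrite (@sum_convE _ (fun i j => a i * b j)) mulr_suml.
apply: ler_sum => i _; rewrite mulr_sumr big_mkcond; apply: ler_sum => j _.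
by case: ifP => // _; rewrite mulr_ge0.
Qed.

(** The square [i, j < M] lies in the triangle [i + j < N], because [i + j <= 2M - 2 < N]. *)
Lemma sum_conv_ge a b M N : (forall i, 0 <= a i) -> (forall i, 0 <= b i) ->
  (M + M <= N.+1)%N ->
  (\sum_(i < M) a i) * (\sum_(j < M) b j) <= \sum_(n < N) conv a b n.
Proof.
move=> a0 b0 MN; rewrite (@sum_convE _ (fun i j => a i * b j)).
case: M MN => [|M] MN; first by rewrite big_ord0 mul0r; do 2!apply: sumr_ge0 => ? _; rewrite mulr_ge0.
have MN' : (M.+1 <= N)%N by lia.
rewrite (big_ord_widen N a MN') big_mkcond mulr_suml; apply: ler_sum => i _.
case: ifP => iM; last by rewrite mul0r sumr_ge0// => j _; rewrite mulr_ge0.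
rewrite mulr_sumr (big_ord_widen N (fun j => a i * b j) MN') big_mkcond [leRHS]big_mkcond.
apply: ler_sum => j _; case: ifP => jM; case: ifP => ij//; rewrite ?mulr_ge0//.
lia.
Qed.

(* [u] is the inverse of [1 - 2c] for the convolution product, so that the
   affine equation [x = y + 2 c * x] has the solution [u * y]. *)
Section Resolvent.
Variables c u : nat -> R.
Hypothesis c0 : c 0%N = 0.
Hypothesis uE : forall n, u n = delta R 0 n + 2 * conv c u n.

Lemma resolvent_eq x y N :
  (forall n, (n <= N)%N -> x n = y n + 2 * conv c x n) ->
  forall n, (n <= N)%N -> x n = conv u y n.
Proof.
move=> xE; elim/ltn_ind => n IH nN.
rewrite xE// (@eq_conv _ u (fun n => delta R 0 n + 2 * conv c u n) y y)//.
rewrite [RHS]convC convDr convZr [X in _ = X + _]convC conv_delta subn0 /=; congr (_ + 2 * _).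
rewrite [RHS]convC -convA; apply: eq_bigr => -[[|i] Hi] _ /=; first by rewrite c0 !mul0r.
by congr (_ * _); rewrite IH; [rewrite convC|lia|lia].
Qed.

Hypothesis c_ge0 : forall n, 0 <= c n.

Lemma resolvent_le x y N :
  (forall n, (n <= N)%N -> x n <= y n + 2 * conv c x n) ->
  forall n, (n <= N)%N -> x n <= conv u y n.
Proof.
move=> xE; elim/ltn_ind => n IH nN; apply: le_trans (xE _ nN) _.
rewrite [leRHS](@eq_conv _ u (fun n => delta R 0 n + 2 * conv c u n) y y)//.
rewrite [leRHS]convC convDr convZr [X in _ <= X + _]convC conv_delta subn0 /= lerD2l ler_pM2l//.
rewrite [leRHS]convC -convA; apply: ler_sum => -[[|i] Hi] _ /=; first by rewrite c0 !mul0r.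
by rewrite ler_wpM2l//; apply: IH; lia.
Qed.

End Resolvent.
End Positivity.

Section Rising.
Variable R : realFieldType.
Implicit Types (s t : R) (n : nat).

(* The Taylor coefficients of [(1 - x)^(-s)]. *)
Definition rising s n : R := \prod_(k < n) ((s + k%:R) / k.+1%:R).

Lemma rising0 s : rising s 0 = 1.
Proof. by rewrite /rising big_ord0. Qed.

Lemma risingS s n : rising s n.+1 = rising s n * ((s + n%:R) / n.+1%:R).
Proof. by rewrite /rising big_ord_recr. Qed.

Lemma risingSM s n : n.+1%:R * rising s n.+1 = (s + n%:R) * rising s n.
Proof. by rewrite risingS mulrC -mulrA divfK ?pnatr_eq0// mulrC. Qed.

Lemma rising_zero n : rising 0 n = delta R 0 n.
Proof.
case: n => [|n]; first by rewrite rising0.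
by rewrite /rising big_ord_recl /= addr0 !mul0r.
Qed.

Lemma rising_one n : rising 1 n = 1.
Proof.
elim: n => [|n IH]; first by rewrite rising0.
by rewrite risingS IH mul1r [1 + _]addrC natr1 divff ?pnatr_eq0.
Qed.

Lemma rising_gt0 s n : 0 < s -> 0 < rising s n.
Proof. by move=> s0; apply: prodr_gt0 => k _; rewrite divr_gt0 ?ltr_wpDr. Qed.

(** Chu-Vandermonde, the product of (1 - x)^(-s) and (1 - x)^(-t). The induction differentiates the
    product: [n + 1] is split as [i + (n + 1 - i)] and each part is absorbed by [risingSM]. *)
Lemma conv_rising s t n : conv (rising s) (rising t) n = rising (s + t) n.
Proof.
elim: n => [|n IH]; first by rewrite /conv big_ord1 !rising0 mulr1.
have n0 : n.+1%:R != 0 :> R by rewrite pnatr_eq0.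
apply: (mulfI n0); rewrite risingSM -IH {IH}.
have -> : n.+1%:R * conv (rising s) (rising t) n.+1 =
    \sum_(i < n.+2) (i%:R * rising s i) * rising t (n.+1 - i) +
    \sum_(i < n.+2) rising s i * ((n.+1 - i)%:R * rising t (n.+1 - i)).
  rewrite mulr_sumr -big_split; apply: eq_bigr => i _ /=.
  have -> : n.+1%:R = i%:R + (n.+1 - i)%:R :> R by rewrite -natrD subnKC// -ltnS.
  ring.
rewrite [X in X + _]big_ord_recl [X in _ + X]big_ord_recr /= !mul0r subnn mul0r mulr0 addr0 add0r.
rewrite -big_split mulr_sumr; apply: eq_bigr => i _ /=.
rewrite /bump /= add1n subSS risingSM subSn; last by have := ltn_ord i; lia.
rewrite risingSM.
have -> : n%:R = i%:R + (n - i)%:R :> R by rewrite -natrD subnKC// -ltnS.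
ring.
Qed.

End Rising.

(* [4^-n] times the number of binary trees with [n] leaves. *)
HB.lock Definition catalan (R : realFieldType) (n : nat) : R :=
  if n is 0%N then 0 else - (1 / 2) * rising (- (1 / 2)) n.

(** * Catalan and central binomial coefficients *)

Section Catalan.
Variable R : realFieldType.

(* [4^-n] times the central binomial coefficient. *)
Definition cbin (n : nat) : R := rising (1 / 2) n.

Local Notation catalan := (catalan R).

Lemma catalan0 : catalan 0 = 0.
Proof. by rewrite catalan.unlock. Qed.

Lemma catalanSM n : (0 < n)%N -> n.+1%:R * catalan n.+1 = (n%:R - 1 / 2) * catalan n.
Proof.
case: n => // n _; rewrite catalan.unlock mulrCA risingSM; set r := rising _ _.
ring.
Qed.

Lemma catalan1 : catalan 1 = 1 / 4.
Proof. by rewrite catalan.unlock risingS rising0; field. Qed.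

Lemma cbinSM n : n.+1%:R * cbin n.+1 = (n%:R + 1 / 2) * cbin n.
Proof. by rewrite risingSM addrC. Qed.

Lemma cbin_gt0 n : 0 < cbin n.
Proof. by apply: rising_gt0; lra. Qed.

Lemma cbin_ge0 n : 0 <= cbin n. Proof. exact: ltW (cbin_gt0 n). Qed.

Lemma cbinE n : (0 < n)%N -> cbin n = 2 * (2 * n%:R - 1) * catalan n.
Proof.
elim: n => // -[_ _|n IH _].
  by rewrite catalan1 /cbin risingS rising0; field.
have n0 : n.+2%:R != 0 :> R by rewrite pnatr_eq0.
apply: (mulfI n0); rewrite cbinSM IH// [RHS]mulrCA catalanSM//.
rewrite -(natr1 n.+1); by field.
Qed.

Lemma catalan_gt0 n : (0 < n)%N -> 0 < catalan n.
Proof.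
move=> n0; have := cbin_gt0 n; rewrite cbinE// pmulr_rgt0//.
have : 1 <= n%:R :> R by rewrite ler1n.
lra.
Qed.

Lemma catalan_ge0 n : 0 <= catalan n.
Proof. by case: n => [|n]; [rewrite catalan0|apply/ltW/catalan_gt0]. Qed.

Lemma catalan_pred n : n.+1%:R * catalan n.+1 = cbin n / 4.
Proof.
case: n => [|n]; first by rewrite catalan1 /cbin rising0; ring.
by rewrite catalanSM// cbinE//; field.
Qed.

Lemma cbin_resolvent n : cbin n = delta R 0 n + 2 * conv catalan cbin n.
Proof.
have E := conv_rising (- (1 / 2)) (1 / 2 : R) n.
rewrite addNr rising_zero in E; rewrite -E -convZl.
have := conv_delta 0 cbin n; rewrite leq0n subn0 => <-.
rewrite /conv -big_split; apply: eq_bigr => -[[|i] Hi] _ /=.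
  by rewrite /delta /cbin catalan0 /= rising0 mulr0 mul0r addr0.
by rewrite /delta mul0r catalan.unlock /cbin; set x := rising _ _; set y := rising _ _; field.
Qed.

Lemma cbin_le n m : (n <= m)%N -> cbin m <= cbin n.
Proof.
move/subnKC <-; elim: (m - n)%N => [|k IH]; first by rewrite addn0.
rewrite addnS; apply: le_trans IH; set j := (n + k)%N.
have j0 : 0 < j.+1%:R :> R by [].
rewrite -(ler_pM2l j0) cbinSM -(natr1 j) ler_pM2r ?cbin_gt0//.
lra.
Qed.

Lemma catalan_le n m : (0 < n <= m)%N -> catalan m <= catalan n.
Proof.
move=> /andP[n0 /subnKC <-]; elim: (m - n)%N => [|k IH]; first by rewrite addn0.
rewrite addnS; apply: le_trans IH; set j := (n + k)%N.
have jn : (0 < j)%N by rewrite /j; lia.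
have j0 : 0 < j.+1%:R :> R by [].
rewrite -(ler_pM2l j0) catalanSM// -(natr1 j) ler_pM2r ?catalan_gt0//.
lra.
Qed.

(** The product is nondecreasing in [n], since (n + 1/2)^2 >= n (n + 1), and equals 1/4 at
    [n = 1]. *)
Lemma cbin_sqr_ge n : (0 < n)%N -> 1 / 4 <= n%:R * cbin n ^+ 2.
Proof.
elim: n => // -[_ _|n IH _]; first by rewrite /cbin risingS rising0; lra.
apply: le_trans (IH isT) _.
have n0 : 0 < n.+2%:R :> R by [].
rewrite -(ler_pM2l n0).
have -> : n.+2%:R * (n.+2%:R * cbin n.+2 ^+ 2) = (n.+2%:R * cbin n.+2) ^+ 2 by ring.
rewrite cbinSM exprMn mulrA ler_pM2r ?exprn_gt0 ?cbin_gt0// -(natr1 n.+1).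
have := ler0n R n.+1; set x := n.+1%:R; nra.
Qed.

Lemma sum_cbin n : \sum_(k < n.+1) cbin k = (2 * n%:R + 1) * cbin n.
Proof.
elim: n => [|n IH]; first by rewrite big_ord1; lra.
rewrite big_ord_recr IH /=.
have -> : (2 * n%:R + 1) * cbin n = 2 * ((n%:R + 1 / 2) * cbin n) by field.
by rewrite -cbinSM -(natr1 n); ring.
Qed.

Lemma sum_catalan n : \sum_(k < n.+1) catalan k = (1 - cbin n) / 2.
Proof.
elim: n => [|n IH]; first by rewrite big_ord1 catalan0 /cbin rising0 subrr mul0r.
rewrite big_ord_recr IH /=.
have := @cbinE n.+1 isT; have := @catalan_pred n.
rewrite -(natr1 n). lra.
Qed.

Definition catalan_window a n : R := if (a <= n < a + a)%N then catalan n else 0.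

Lemma catalan_window_ge0 a n : 0 <= catalan_window a n.
Proof. by rewrite /catalan_window; case: ifP; rewrite ?catalan_ge0. Qed.

(** The window holds [a] terms, each at least [catalan (2a)], and [cbin (2a) <= 8 a catalan (2a)].
    Squaring [cbin (2a) / 8] and using [cbin_sqr_ge] gives 1/64 times 1/(8a). *)
Lemma sum_catalan_window_sqr a : (0 < a)%N ->
  1 / (512 * a%:R) <= (\sum_(i < a + a) catalan_window a i) ^+ 2.
Proof.
move=> a0; rewrite big_split_ord /= big1 ?add0r => [|i _]; last first.
  by rewrite /catalan_window leqNgt ltn_ord.
have ar : 0 < a%:R :> R by rewrite ltr0n.
have Hw := cbin_gt0 (a + a).
have : cbin (a + a) / 8 <= \sum_(i < a) catalan_window a (a + i).
  apply: (@le_trans _ _ (\sum_(i < a) catalan (a + a))).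
    rewrite big_const_ord iter_addr_0 -mulr_natl.
    have -> : cbin (a + a) = 2 * (2 * (a + a)%:R - 1) * catalan (a + a).
      by apply: cbinE; lia.
    have := catalan_ge0 (a + a); rewrite natrD; nra.
  apply: ler_sum => i _; rewrite /catalan_window leq_addr ltn_add2l ltn_ord /=.
  by apply: catalan_le; have := ltn_ord i; lia.
move=> H; have := @cbin_sqr_ge (a + a) ltac:(lia); rewrite natrD => H'.
apply: (@le_trans _ _ ((cbin (a + a) / 8) ^+ 2)).
  rewrite ler_pdivrMr; nra.
by rewrite ler_sqr ?nnegrE//; nra.
Qed.

End Catalan.

(** * Sums over signed trees *)

Lemma leaves_gt0 t : (0 < leaves t)%N.
Proof. by elim: t => //= _ l Hl r _; rewrite addn_gt0 Hl. Qed.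

Section TreeSums.
Variables (R : realType) (p : R).
Implicit Types (phi psi : stree -> R) (t l r : stree).

Definition tsum (n : nat) phi : R :=
  4^-1 ^+ n * \sum_(t <- trees_of n) sweight p t * phi t.

Definition coin phi l r : R :=
  p * phi (Node true l r) + (1 - p) * phi (Node false l r).

(** The enumeration recurses on depth while the recursion wanted is on size. Depth and size are kept
    apart here until [dsum_depth] shows that any depth [d >= n] gives the same sum. *)
Let dsum (d n : nat) phi : R :=
  \sum_(t <- trees_depth d | leaves t == n) sweight p t * phi t.

Lemma sweight_node s l r :
  sweight p (Node s l r) = (if s then p else 1 - p) * (sweight p l * sweight p r).
Proof.
rewrite /sweight /=; case: s => /=; rewrite ?add0n ?add1n !exprD ?exprS; ring.
Qed.

Let dsumS d (n : nat) phi : dsum d.+1 n phi = (n == 1)%:R * phi Leaf +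
  \sum_(i < n.+1) dsum d i (fun l => dsum d (n - i)%N (fun r => coin phi l r)).
Proof.
pose D := trees_depth d.
have -> : \sum_(i < n.+1) dsum d i (fun l => dsum d (n - i)%N (fun r => coin phi l r))
  = \sum_(l <- D) \sum_(r <- D) (if (leaves l + leaves r == n)%N
      then sweight p l * sweight p r * coin phi l r else 0).
  transitivity (\sum_(i < n.+1) \sum_(l <- D) \sum_(r <- D)
    (if (leaves l == i) && (leaves r == n - i)%N
      then sweight p l * sweight p r * coin phi l r else 0)).
    apply: eq_bigr => i _; rewrite /dsum big_mkcond; apply: eq_bigr => l _.
    case: eqP => /= _; last by rewrite big1.
    rewrite mulr_sumr big_mkcond; apply: eq_bigr => r _.
    by case: eqP => // _; rewrite mulrA.
  rewrite exchange_big; apply: eq_bigr => l _.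
  rewrite exchange_big; apply: eq_bigr => r _ /=.
  case: eqP => [E|E].
    have ln : (leaves l < n.+1)%N by lia.
    have Er : (n - leaves l)%N = leaves r by lia.
    rewrite (bigD1 (Ordinal ln))//= eqxx Er eqxx big1 ?addr0// => i /eqP ne.
    by case: eqP => // Ei; case: ne; apply: val_inj.
  apply: big1 => i _; case: eqP => //= Ei; case: eqP => // Er.
  by case: E; rewrite Ei Er; have := ltn_ord i; lia.
rewrite /dsum /= big_cons cats0 big_cat /= eq_sym.
rewrite !(big_mkcond (fun t => leaves t == n)) !big_allpairs_dep /=.
have -> : sweight p Leaf = 1 by rewrite /sweight /= mul1r.
have -> : \sum_(l <- D) \sum_(r <- D) (if (leaves l + leaves r == n)%N
      then sweight p l * sweight p r * coin phi l r else 0) =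
   \sum_(l <- D) \sum_(r <- D) (if (leaves l + leaves r == n)%N
      then sweight p (Node true l r) * phi (Node true l r) else 0) +
   \sum_(l <- D) \sum_(r <- D) (if (leaves l + leaves r == n)%N
      then sweight p (Node false l r) * phi (Node false l r) else 0).
  rewrite -big_split; apply: eq_bigr => l _; rewrite -big_split; apply: eq_bigr => r _ /=.
  by case: ifP => _; rewrite ?addr0// !sweight_node /coin; ring.
by case: eqP => _; rewrite ?mul1r ?mul0r ?add0r.
Qed.

Let dsum0 d phi : dsum d 0 phi = 0.
Proof. by apply: big1 => t /eqP; have := leaves_gt0 t; lia. Qed.

Let dsum_depth d n phi : (n <= d)%N -> dsum d n phi = dsum n n phi.
Proof.
elim/ltn_ind: n d phi => -[|n] IH d phi; first by rewrite !dsum0.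
case: d => // d nd; rewrite !dsumS; congr (_ + _); apply: eq_bigr => i _.
have Hi := ltn_ord i.
have [i0|i0] := posnP i; first by rewrite i0 !dsum0.
(* The induction hypothesis does not reach [i = n + 1], but then the other subtree would have no
   leaves and the term vanishes. *)
have [iN|iN] := eqVneq (nat_of_ord i) n.+1.
  have E0 k : dsum k (n.+1 - i)%N = fun=> 0.
    by rewrite iN subnn; apply/funext => f; rewrite dsum0.
  by rewrite !E0 /dsum !big1// => t _; rewrite mulr0.
rewrite (IH i)//; [|lia..]; rewrite (IH i _ n)//; [|lia..].
congr (dsum _ _ _); apply/funext => l.
by rewrite (IH (n.+1 - i)%N); [rewrite (IH _ _ n)//|..]; lia.
Qed.

Let tsum_dsum d n phi : (n <= d)%N -> tsum n phi = 4^-1 ^+ n * dsum d n phi.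
Proof. by move=> nd; rewrite /tsum big_filter dsum_depth. Qed.

Lemma tsum0 phi : tsum 0 phi = 0.
Proof. by rewrite (@tsum_dsum 0)// dsum0 mulr0. Qed.

Lemma tsumZ n x phi : tsum n (fun t => x * phi t) = x * tsum n phi.
Proof.
rewrite /tsum mulrCA; congr (_ * _); rewrite mulr_sumr.
by apply: eq_bigr => t _; rewrite mulrCA.
Qed.

Lemma tsumZr n x phi : tsum n (fun t => phi t * x) = tsum n phi * x.
Proof. by rewrite mulrC -tsumZ; congr tsum; apply/funext => t; rewrite mulrC. Qed.

Lemma tsumD n phi psi : tsum n (fun t => phi t + psi t) = tsum n phi + tsum n psi.
Proof.
rewrite /tsum -mulrDr; congr (_ * _); rewrite -big_split.
by apply: eq_bigr => t _; rewrite mulrDr.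
Qed.

Lemma tsumB n phi psi : tsum n (fun t => phi t - psi t) = tsum n phi - tsum n psi.
Proof.
rewrite tsumD; congr (_ + _); rewrite -mulN1r -tsumZ.
by congr tsum; apply/funext => t; rewrite mulN1r.
Qed.

(** Decomposition at the root, from which the recursions below are read off; the first term is the
    one-leaf tree with weight 1/4. *)
Lemma tsumE n phi : tsum n phi = (n == 1)%:R / 4 * phi Leaf +
  \sum_(i < n.+1) tsum i (fun l => tsum (n - i)%N (fun r => coin phi l r)).
Proof.
rewrite (@tsum_dsum n.+1)// dsumS mulrDr; congr (_ + _).
  by case: eqP => [->|_]; rewrite ?expr1 ?mul1r// !mul0r mulr0.
rewrite mulr_sumr; apply: eq_bigr => i _; have Hi := ltn_ord i.
rewrite (@tsum_dsum n); last by lia.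
have -> : 4^-1 ^+ n = 4^-1 ^+ i * 4^-1 ^+ (n - i) :> R by rewrite -exprD subnKC//; lia.
rewrite -mulrA; congr (_ * _).
rewrite mulr_sumr; apply: eq_bigr => t _; rewrite mulrCA; congr (_ * _).
by rewrite (@tsum_dsum n)//; lia.
Qed.

Lemma tsum_zero n : tsum n (fun=> 0) = 0.
Proof. by rewrite /tsum big1 ?mulr0// => t _; rewrite mulr0. Qed.

Lemma eq_tsum n phi psi : (forall t, leaves t = n -> phi t = psi t) ->
  tsum n phi = tsum n psi.
Proof.
move=> H; rewrite /tsum; congr (_ * _); rewrite /trees_of !big_filter.
by apply: eq_bigr => t /eqP /H ->.
Qed.

Hypotheses (p_ge0 : 0 <= p) (p_le1 : p <= 1).

Lemma sweight_ge0 t : 0 <= sweight p t.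
Proof. by rewrite /sweight mulr_ge0// exprn_ge0// subr_ge0. Qed.

Lemma tsum_le n phi psi : (forall t, leaves t = n -> phi t <= psi t) ->
  tsum n phi <= tsum n psi.
Proof.
move=> H; rewrite /tsum ler_wpM2l ?exprn_ge0 ?invr_ge0//.
rewrite /trees_of !big_filter; apply: ler_sum => t /eqP tn.
by rewrite ler_wpM2l ?sweight_ge0 ?H.
Qed.

Lemma tsum_ge0 n phi : (forall t, leaves t = n -> 0 <= phi t) -> 0 <= tsum n phi.
Proof. by move=> H; rewrite -(tsum_zero n); apply: tsum_le. Qed.

End TreeSums.

(** * The recursion for [LIS] and its behaviour under leaf deletion *)

Section LISRecursion.
Local Notation restrict := Defs.restrict.
Local Open Scope nat_scope.
Implicit Types (t l r : stree) (m : seq bool).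

Lemma isSome_restrict t m : size m = leaves t ->
  isSome (restrict t m) = (0 < count id m).
Proof.
elim: t m => [|s l IHl r IHr] m /=.
  by case: m => [|[] [|? ?]].
move=> sm; have sl : size (take (leaves l) m) = leaves l.
  by rewrite size_take; case: ltnP; lia.
have sr : size (drop (leaves l) m) = leaves r by rewrite size_drop; lia.
have -> : count id m = count id (take (leaves l) m) + count id (drop (leaves l) m).
  by rewrite -count_cat cat_take_drop.
rewrite addn_gt0 -IHl// -IHr//.
by case: restrict => [?|]; case: restrict => [?|].
Qed.

Lemma restrict_nseq_false t : restrict t (nseq (leaves t) false) = None.
Proof.
have := @isSome_restrict t (nseq (leaves t) false).
by rewrite size_nseq count_nseq mul0n; case: restrict => // ? /(_ erefl).
Qed.

Lemma LIS_ub t m : size m = leaves t -> positive_restr t m ->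
  count id m <= LIS t.
Proof.
move=> /eqP sm pm.
exact: (@leq_bigmax_cond _ (fun m : (leaves t).-tuple bool => positive_restr t m)
  (fun m : (leaves t).-tuple bool => count id m) (Tuple sm) pm).
Qed.

Lemma LIS_le t k :
  (forall m, size m = leaves t -> positive_restr t m -> count id m <= k) ->
  LIS t <= k.
Proof. by move=> H; apply/bigmax_leqP => m pm; apply: H; rewrite ?size_tuple. Qed.

Lemma LIS_attained t : exists m, [/\ size m = leaves t, positive_restr t m
  & count id m = LIS t].
Proof.
suff [m0 pm0] : exists m : (leaves t).-tuple bool, positive_restr t m.
  rewrite /LIS; have [|m pm Em] := @eq_bigmax_cond _
    (fun m : (leaves t).-tuple bool => positive_restr t m)
    (fun m : (leaves t).-tuple bool => count id m).
    by apply/card_gt0P; exists m0.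
  by exists m; rewrite size_tuple.
suff [m [/eqP sm pm]] : exists m, size m = leaves t /\ positive_restr t m.
  by exists (Tuple sm).
elim: t => [|s l [m [sm pm]] r _]; first by exists [:: true].
exists (m ++ nseq (leaves r) false); rewrite size_cat size_nseq sm; split=> //.
have rN := restrict_nseq_false r.
move: pm; rewrite /positive_restr /= -sm take_size_cat// drop_size_cat// rN.
by case: restrict.
Qed.

Lemma LIS_gt0 t : 0 < LIS t.
Proof.
have [m [sm pm <-]] := LIS_attained t.
rewrite -(isSome_restrict sm); move: pm; rewrite /positive_restr.
by case: restrict.
Qed.

Lemma LIS_leaf : LIS Leaf = 1.
Proof.
apply/eqP; rewrite eqn_leq LIS_gt0 andbT; apply: LIS_le => -[|[] [|? ?]]//=.
Qed.

(** A mask that meets both sides keeps the root, so under a [-] root a positive subtree lives on one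
    side. Conversely, optimal masks of the children are concatenated, or padded with [false]. *)
Lemma LIS_node s l r :
  LIS (Node s l r) = if s then LIS l + LIS r else maxn (LIS l) (LIS r).
Proof.
have [ml [sl pl cl]] := LIS_attained l; have [mr [sr pr cr]] := LIS_attained r.
apply/eqP; rewrite eqn_leq; apply/andP; split.
  apply: LIS_le => m /= sm.
  have sl' : size (take (leaves l) m) = leaves l.
    by rewrite size_take; case: ltnP; lia.
  have sr' : size (drop (leaves l) m) = leaves r by rewrite size_drop; lia.
  have := LIS_ub sl'; have := LIS_ub sr'.
  have := isSome_restrict sl'; have := isSome_restrict sr'.
  have -> : count id m = count id (take (leaves l) m) + count id (drop (leaves l) m).
    by rewrite -count_cat cat_take_drop.
  rewrite /positive_restr /=.
  case: restrict => [u|] /=; case: restrict => [v|] /=.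
  - move=> _ _ Hr Hl; case: s => //= /andP[pu pv]; exact: leq_add (Hl pu) (Hr pv).
  - by move=> _ l0 Hr _ /Hr; case: s; lia.
  - by move=> r0 _ _ Hl /Hl; case: s; lia.
  - by [].
have NN := restrict_nseq_false.
have Hl : LIS l <= LIS (Node s l r).
  have := @LIS_ub (Node s l r) (ml ++ nseq (leaves r) false).
  rewrite size_cat size_nseq /= sl count_cat count_nseq mul0n addn0 cl; apply=> //.
  move: pl; rewrite /positive_restr /= -sl take_size_cat// drop_size_cat// NN.
  by case: restrict.
have Hr : LIS r <= LIS (Node s l r).
  have := @LIS_ub (Node s l r) (nseq (leaves l) false ++ mr).
  rewrite size_cat size_nseq /= sr count_cat count_nseq mul0n add0n cr; apply=> //.
  move: pr; rewrite /positive_restr /= take_size_cat ?size_nseq// drop_size_cat ?size_nseq// NN.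
  by case: restrict.
case: s Hl Hr => Hl Hr; last by rewrite geq_max Hl.
have := @LIS_ub (Node true l r) (ml ++ mr).
rewrite size_cat /= sl sr count_cat cl cr; apply => //.
move: pl pr; rewrite /positive_restr /= -sl take_size_cat// drop_size_cat//.
by case: restrict => // u; case: restrict => // v /= -> ->.
Qed.

Lemma LIS_le_leaves t : LIS t <= leaves t.
Proof.
elim: t => [|s l Hl r Hr]; first by rewrite LIS_leaf.
by rewrite LIS_node /=; case: s; lia.
Qed.

Lemma LIS_node_maxn s l r : maxn (LIS l) (LIS r) <= LIS (Node s l r).
Proof. by rewrite LIS_node; case: s; lia. Qed.

Definition is_leaf t : bool := if t is Leaf then true else false.

(** One entry per deleted leaf, repetitions kept, as the double counting requires. A single leaf
    gets the empty list because nothing would remain. *)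
Fixpoint deletions t : seq stree :=
  match t with
  | Leaf => [::]
  | Node s l r =>
      (if is_leaf l then [:: r] else [seq Node s u r | u <- deletions l]) ++
      (if is_leaf r then [:: l] else [seq Node s l u | u <- deletions r])
  end.

Lemma size_deletions t : ~~ is_leaf t -> size (deletions t) = leaves t.
Proof.
elim: t => // s l IHl r IHr _ /=; rewrite size_cat; congr (_ + _).
  by case: l IHl => // ? ? ? IHl; rewrite /= size_map IHl.
by case: r IHr => // ? ? ? IHr; rewrite /= size_map IHr.
Qed.

Lemma LIS_deletion t u : List.In u (deletions t) -> LIS u <= LIS t.
Proof.
elim: t u => // s l IHl r IHr u /=.
move=> /(List.in_app_or _ _ _)[].
  case: ifP => _ /=.
    by case=> // <-; have := LIS_node_maxn s l r; lia.
  move=> /(List.in_map_iff _ _ _)[v [<- /IHl]].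
  by rewrite !LIS_node; case: s; lia.
case: ifP => _ /=.
  by case=> // <-; have := LIS_node_maxn s l r; lia.
move=> /(List.in_map_iff _ _ _)[v [<- /IHr]].
by rewrite !LIS_node; case: s; lia.
Qed.

End LISRecursion.

(** * Deleting a uniform leaf from a uniform tree *)

Section Deletion.
Variables (R : realType) (p : R).
Implicit Types (phi psi : stree -> R) (t l r : stree).

Definition delsum phi t : R := \sum_(u <- deletions t) phi u.

Lemma delsum_node phi s l r : delsum phi (Node s l r) =
  ((is_leaf l)%:R * phi r + delsum (fun u => phi (Node s u r)) l) +
  ((is_leaf r)%:R * phi l + delsum (fun u => phi (Node s l u)) r).
Proof.
rewrite /delsum /= big_cat; congr (_ + _).
  by case: l => [|? ? ?] /=; rewrite ?big_map ?mul0r ?add0r// big_seq1 big_nil mul1r addr0.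
by case: r => [|? ? ?] /=; rewrite ?big_map ?mul0r ?add0r// big_seq1 big_nil mul1r addr0.
Qed.

Lemma tsum_is_leaf n phi :
  tsum p n (fun t => (is_leaf t)%:R * phi t) = (n == 1)%:R / 4 * phi Leaf.
Proof.
rewrite tsumE [X in _ + X]big1 ?addr0 => [|i _]; first by rewrite [is_leaf _]/= mul1r.
apply: (etrans _ (tsum_zero p i)); congr tsum; apply/funext => l.
apply: (etrans _ (tsum_zero p (n - i))); congr tsum; apply/funext => r.
by rewrite /coin !mul0r !mulr0 addr0.
Qed.

Lemma tsum_sum n (I : Type) (s : seq I) (F : stree -> I -> R) :
  tsum p n (fun t => \sum_(i <- s) F t i) = \sum_(i <- s) tsum p n (F ^~ i).
Proof.
rewrite /tsum -mulr_sumr exchange_big; congr (_ * _); apply: eq_bigr => t _ /=.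
by rewrite mulr_sumr.
Qed.

Lemma tsum_exchange i j (F : stree -> stree -> R) :
  tsum p i (fun l => tsum p j (F l)) = tsum p j (fun r => tsum p i (F ^~ r)).
Proof.
rewrite {2 4}/tsum !tsumZ /tsum; rewrite mulrCA; congr (_ * (_ * _)).
under eq_bigr do rewrite mulr_sumr.
rewrite exchange_big; apply: eq_bigr => r _; rewrite mulr_sumr.
by apply: eq_bigr => l _; rewrite mulrCA.
Qed.

Lemma leaves_eq1 t : leaves t = 1 -> t = Leaf.
Proof. by case: t => //= s l r; have := leaves_gt0 l; have := leaves_gt0 r; lia. Qed.

Lemma tsum1_delsum phi : tsum p 1 (delsum phi) = 0.
Proof.
rewrite -(tsum_zero p 1); apply: eq_tsum => t /leaves_eq1 ->.
by rewrite /delsum big_nil.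
Qed.

Lemma tsum_fun0 (phi : stree -> R) n : (forall t, phi t = 0) -> tsum p n phi = 0.
Proof. by move=> H; rewrite -(tsum_zero p n); congr tsum; apply/funext. Qed.

(* Double counting of the pairs (tree with [n + 1] leaves, deleted leaf): a tree
   with [n] leaves arises by deletion from [2 (2n - 1)] of them. *)
Lemma tsum_delsum n phi : (0 < n)%N ->
  tsum p n.+1 (delsum phi) = (n%:R - 1 / 2) * tsum p n phi.
Proof.
elim/ltn_ind: n phi => n IH phi n0.
pose Q k := tsum p k (fun l => tsum p (n - k) (coin p phi l)).
have Q0 : Q 0%N = 0 by rewrite /Q tsum0.
have Qn : Q n = 0 by apply: tsum_fun0 => l; rewrite subnn tsum0.
rewrite tsumE eqSS (negbTE (lt0n_neq0 n0)) !mul0r add0r.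
(* In [T1] and [T3] the deleted leaf is itself a child of the root; in [T2] and [T4] it lies deeper
   in the left or right subtree. *)
pose T1 i := tsum p i (fun l => tsum p (n.+1 - i) (fun r => (is_leaf l)%:R * phi r)).
pose T2 i := tsum p i (fun l => tsum p (n.+1 - i)
  (fun r => delsum (fun u => coin p phi u r) l)).
pose T3 i := tsum p i (fun l => tsum p (n.+1 - i) (fun r => (is_leaf r)%:R * phi l)).
pose T4 i := tsum p i (fun l => tsum p (n.+1 - i) (delsum (coin p phi l))).
transitivity (\sum_(i < n.+2) ((T1 i + T2 i) + (T3 i + T4 i))).
  apply: eq_bigr => i _; rewrite /T1 /T2 /T3 /T4 -!tsumD; congr tsum.
  apply/funext => l; rewrite -!tsumD; congr tsum; apply/funext => r.
  rewrite /coin !delsum_node /delsum !big_split /= -!mulr_sumr; ring.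
have E1 : \sum_(i < n.+2) T1 i = 1 / 4 * tsum p n phi.
  have T1E i : T1 i = (i == 1)%:R / 4 * tsum p (n.+1 - i) phi.
    rewrite /T1 -(tsum_is_leaf i (fun=> tsum p (n.+1 - i) phi)).
    by congr tsum; apply/funext => l; rewrite tsumZ.
  rewrite 2!big_ord_recl big1 ?addr0 => [|i _]; last by rewrite T1E !mul0r.
  by rewrite !T1E /bump /= !mul0r add0r subSS subn0.
have E3 : \sum_(i < n.+2) T3 i = 1 / 4 * tsum p n phi.
  have T3E i : T3 i = (n.+1 - i == 1)%N%:R / 4 * tsum p i phi.
    rewrite /T3 -tsumZ; congr tsum; apply/funext => l.
    by rewrite (tsum_is_leaf (n.+1 - i)%N (fun=> phi l)).
  rewrite 2!big_ord_recr big1 ?add0r => [|i _]; last first.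
    by rewrite T3E; case: eqP; rewrite ?mul0r//=; have := ltn_ord i; lia.
  by rewrite !T3E /= subnn subSnn eqxx add0r (_ : (0 == 1)%N = false)// !mul0r addr0.
have E2 : \sum_(i < n.+2) T2 i = \sum_(k < n.+1) (k%:R - 1 / 2) * Q k.
  have T2E i : T2 i = tsum p (n.+1 - i)
      (fun r => tsum p i (delsum (fun u => coin p phi u r))).
    by rewrite /T2 tsum_exchange.
  rewrite big_ord_recl [X in X + _]T2E tsum_fun0 => [|t]; last exact: tsum0.
  rewrite add0r; apply: eq_bigr => k _; rewrite /bump /= T2E subSS.
  have kn := ltn_ord k; have [k0|k0] := posnP k.
    by rewrite k0 Q0 mulr0 tsum_fun0// => t; rewrite tsum1_delsum.
  have [->|kn'] := eqVneq (nat_of_ord k) n; first by rewrite Qn mulr0 subnn tsum0.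
  rewrite /Q [in RHS]tsum_exchange -tsumZ; congr tsum; apply/funext => r.
  by rewrite IH//; lia.
have E4 : \sum_(i < n.+2) T4 i = \sum_(k < n.+1) ((n - k)%:R - 1 / 2) * Q k.
  rewrite big_ord_recr /= {2}/T4 tsum_fun0 ?addr0 => [|t]; last by rewrite subnn tsum0.
  apply: eq_bigr => k _.
  have kn := ltn_ord k; have [k0|k0] := posnP k.
    by rewrite k0 Q0 mulr0 /T4 tsum0.
  have [->|kn'] := eqVneq (nat_of_ord k) n.
    by rewrite Qn mulr0 /T4 tsum_fun0// => t; rewrite subSnn tsum1_delsum.
  rewrite /Q /T4 -tsumZ; congr tsum; apply/funext => l.
  by rewrite subSn ?IH//; lia.
rewrite !big_split /= E1 E2 E3 E4.
(* The coefficients k - 1/2 and n - k - 1/2 add up to n - 1; the missing 1/2 comes from the two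
   quarters in [E1] and [E3]. *)
have E : \sum_(k < n.+1) (k%:R - 1 / 2) * Q k + \sum_(k < n.+1) ((n - k)%:R - 1 / 2) * Q k
   = (n%:R - 1) * \sum_(k < n.+1) Q k.
  rewrite -big_split mulr_sumr; apply: eq_bigr => k _ /=.
  by rewrite natrB; [field|have := ltn_ord k; lia].
have EQ : tsum p n phi = (n == 1)%:R / 4 * phi Leaf + \sum_(k < n.+1) Q k := tsumE p n phi.
have H : (n%:R - 1) * (n == 1)%:R = 0 :> R.
  by case: eqP => [->|_]; rewrite ?subrr ?mul0r ?mulr0.
move: E EQ; set S := \sum_(k < n.+1) Q k; set A := \sum_(k < n.+1) _.
set B := \sum_(k < n.+1) _; set x := tsum p n phi => E EQ.
have -> : 1 / 4 * x + A + (1 / 4 * x + B) = (A + B) + 1 / 2 * x by field.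
have -> : (n%:R - 1 / 2) * x = (n%:R - 1) * x + 1 / 2 * x by field.
have -> : (n%:R - 1) * x = (n%:R - 1) * S; last by rewrite E.
by rewrite EQ mulrDr !mulrA H !mul0r add0r.
Qed.

Lemma delsum_one t : delsum (fun=> 1) t = (~~ is_leaf t)%:R * (leaves t)%:R.
Proof.
case: t => [|s l r]; first by rewrite /delsum big_nil mul0r.
by rewrite /delsum big_const_seq count_predT iter_addr_0 size_deletions// mul1r.
Qed.

Hypotheses (p_ge0 : 0 <= p) (p_le1 : p <= 1).

Lemma tsum_one n : tsum p n (fun=> 1) = catalan R n.
Proof.
elim: n => [|[_|n IH]]; first by rewrite tsum0 catalan0.
  rewrite tsumE mulr1 catalan1 big1 ?addr0 => [|i _]; last first.
    by case: i => -[|[|//]] Hi; rewrite ?tsum0// tsum_fun0// => l; rewrite tsum0.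
  by rewrite eqxx.
have n0 : n.+2%:R != 0 :> R by rewrite pnatr_eq0.
apply: (mulfI n0); rewrite catalanSM// -IH -tsum_delsum// -tsumZ.
apply: eq_tsum => t tn; rewrite delsum_one tn mulr1.
by case: t tn => //= _ l r _; rewrite mul1r.
Qed.

Lemma delsum_LIS (g : nat -> R) t : (forall i, 0 <= g i) ->
  {homo g : i j / (i <= j)%N >-> i <= j} ->
  delsum (fun u => g (LIS u)) t <= (leaves t)%:R * g (LIS t).
Proof.
move=> g0 gm; have [|/size_deletions E] := boolP (is_leaf t).
  by case: t => // _; rewrite /delsum big_nil mulr_ge0.
rewrite -E /delsum; have := @LIS_deletion t; elim: (deletions t) => [|u s IH] H /=.
  by rewrite big_nil mul0r.
rewrite big_cons -natr1 mulrDl mul1r addrC lerD//.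
  by apply: IH => v vs; apply: H; right.
by apply/gm/H; left.
Qed.

(** Deleting a uniform leaf of the random tree of size [j + 1] gives the one of size [j] and cannot
    raise [LIS]. It serves for the mean and, with [g] an indicator, for tail probabilities. *)
Lemma tsum_LIS_mono (g : nat -> R) m n : (forall i, 0 <= g i) ->
  {homo g : i j / (i <= j)%N >-> i <= j} -> (0 < m <= n)%N ->
  tsum p m (fun t => g (LIS t)) / catalan R m <= tsum p n (fun t => g (LIS t)) / catalan R n.
Proof.
move=> g0 gm /andP[m0 /subnKC <-]; elim: (n - m)%N => [|k IH]; first by rewrite addn0.
apply: (le_trans IH); rewrite addnS; set j := (m + k)%N.
have j0 : (0 < j)%N by rewrite /j; lia.
have cj := catalan_gt0 R j0; have cj1 := catalan_gt0 R (ltn0Sn j).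
have jr : 1 <= j%:R :> R by rewrite ler1n.
rewrite ler_pdivrMr// mulrAC ler_pdivlMr//.
have jh : 0 < j%:R - 1 / 2 :> R by lra.
rewrite -(ler_pM2l jh) [leLHS]mulrA -tsum_delsum//.
have -> : (j%:R - 1 / 2) * (tsum p j.+1 (fun t => g (LIS t)) * catalan R j) =
  tsum p j.+1 (fun t => g (LIS t)) * (j.+1%:R * catalan R j.+1).
  by rewrite catalanSM//; ring.
rewrite [leRHS]mulrA ler_pM2r// -tsumZr; apply: tsum_le => // t <-.
by rewrite mulrC; apply: delsum_LIS.
Qed.

End Deletion.

(** * The second moment and the upper bound on the growth *)

Section RisingComparison.
Variable R : realFieldType.
Implicit Types (s x : R) (n N : nat).

(** From [j] to [j + 1] the left side gains the factors j - 1/2 and j + 2s + 1/2, the right side (j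
    + s)^2, over the same denominator. The two factors have mean j + s, so AM-GM applies. *)
Lemma catalan_rising_le s x N n : 0 < s -> (0 < N <= n)%N ->
  2 * catalan R N * rising (2 * s + 1 / 2) N <= x * rising s N ^+ 2 ->
  2 * catalan R n * rising (2 * s + 1 / 2) n <= x * rising s n ^+ 2.
Proof.
move=> s0 /andP[N0 /subnKC <-] HN; elim: (n - N)%N => [|k IH]; first by rewrite addn0.
rewrite addnS; set j := (N + k)%N in IH *.
have j0 : (0 < j)%N by rewrite /j; lia.
have jr : 0 < j.+1%:R ^+ 2 :> R by rewrite exprn_gt0.
rewrite -(ler_pM2l jr).
have -> : j.+1%:R ^+ 2 * (x * rising s j.+1 ^+ 2) = x * (j.+1%:R * rising s j.+1) ^+ 2.
  by ring.
have -> : j.+1%:R ^+ 2 * (2 * catalan R j.+1 * rising (2 * s + 1 / 2) j.+1) =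
  2 * (j.+1%:R * catalan R j.+1) * (j.+1%:R * rising (2 * s + 1 / 2) j.+1) by ring.
rewrite catalanSM// !risingSM.
have c0 := catalan_gt0 R j0.
have t0 : 0 < 2 * s + 1 / 2 by lra.
have r0 := rising_gt0 j t0.
have jr1 : 1 <= j%:R :> R by rewrite ler1n.
move: IH; set c := catalan R j in c0 *; set r := rising (2 * s + _) j in r0 *; set y := rising s j.
move=> IH; have cr : 0 < 2 * c * r by rewrite !mulr_gt0.
have -> : 2 * ((j%:R - 1 / 2) * c) * ((2 * s + 1 / 2 + j%:R) * r) =
  (j%:R - 1 / 2) * (2 * s + 1 / 2 + j%:R) * (2 * c * r) by ring.
have -> : x * ((s + j%:R) * y) ^+ 2 = (s + j%:R) ^+ 2 * (x * y ^+ 2) by ring.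
apply: (@le_trans _ _ ((s + j%:R) ^+ 2 * (2 * c * r))); last first.
  by rewrite ler_wpM2l// sqr_ge0.
rewrite ler_pM2r//; nra.
Qed.

(** The constant makes [n = 0] an equality; the step rests on (n + 2)(n + 1/2)^2 <= (n + 1)^3. *)
Lemma catalan_cbin_le s n : 0 < s ->
  catalan R n.+1 * cbin R n <= (4 * s ^+ 2)^-1 * rising s n.+1 ^+ 2.
Proof.
move=> s0; have s2 : 0 < 4 * s ^+ 2 by rewrite mulr_gt0 ?exprn_gt0.
rewrite -(ler_pM2l s2) [leRHS]mulrA divff ?mul1r ?gt_eqF//.
elim: n => [|n IH].
  rewrite catalan1 /cbin rising0 risingS rising0 addr0 divr1 mul1r.
  rewrite le_eqVlt; apply/orP; left; apply/eqP; by field.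
have n0 : 0 < n.+2%:R ^+ 2 * n.+1%:R :> R by rewrite mulr_gt0 ?exprn_gt0.
rewrite -(ler_pM2l n0).
have -> : n.+2%:R ^+ 2 * n.+1%:R * rising s n.+2 ^+ 2 =
   n.+1%:R * (n.+2%:R * rising s n.+2) ^+ 2 by ring.
have -> : n.+2%:R ^+ 2 * n.+1%:R * (4 * s ^+ 2 * (catalan R n.+2 * cbin R n.+1)) =
   n.+2%:R * (4 * s ^+ 2) * ((n.+2%:R * catalan R n.+2) * (n.+1%:R * cbin R n.+1)) by ring.
rewrite catalanSM// cbinSM risingSM -(natr1 n.+1) -(natr1 n).
move: IH; set X := catalan R n.+1; set Y := cbin R n; set Z := rising s n.+1 => IH.
have X0 : 0 <= X := catalan_ge0 R _; have Y0 : 0 <= Y := cbin_ge0 R _.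
have nr := ler0n R n; set m : R := n%:R in nr *.
have -> : (m + 1 + 1) * (4 * s ^+ 2) * ((m + 1 - 1 / 2) * X * ((m + 1 / 2) * Y)) =
   ((m + 2) * (m + 1 / 2) ^+ 2) * (4 * s ^+ 2 * (X * Y)) by field.
have -> : (m + 1) * ((s + (m + 1)) * Z) ^+ 2 = ((m + 1) * (s + (m + 1)) ^+ 2) * Z ^+ 2 by ring.
apply: ler_pM => //; first by rewrite mulr_ge0 ?sqr_ge0//; lra.
  by apply: mulr_ge0; [exact: ltW|exact: mulr_ge0].
nra.
Qed.

(** Quantifies that [rising s] is close to [cbin] for s near 1/2: factor by factor, s + k >= 2s (k +
    1/2). *)
Lemma rising_half_le s n : 0 < s -> s <= 1 / 2 ->
  (2 * s) ^+ n * cbin R n <= rising s n.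
Proof.
move=> s0 s1; elim: n => [|n IH]; first by rewrite /cbin !rising0 mulr1.
have n0 : 0 < n.+1%:R :> R by [].
rewrite -(ler_pM2l n0) risingSM exprSr mulrCA cbinSM.
have -> : (2 * s) ^+ n * (2 * s) * ((n%:R + 1 / 2) * cbin R n) =
  (2 * s * (n%:R + 1 / 2)) * ((2 * s) ^+ n * cbin R n) by ring.
have nr := ler0n R n.
apply: ler_pM => //; rewrite ?mulr_ge0 ?exprn_ge0 ?cbin_ge0//; [lra..|].
by nra.
Qed.

Lemma rising_le s t n : 0 < s -> s <= t -> rising s n <= rising t n.
Proof.
move=> s0 st; apply: ler_prod => k _; apply/andP; split.
  by rewrite divr_ge0// addr_ge0// ltW.
by rewrite ler_wpM2r ?invr_ge0// lerD2r.
Qed.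

Lemma rising_three_half n : rising (3 / 2) n = (2 * n%:R + 1) * cbin R n.
Proof.
elim: n => [|n IH]; first by rewrite /cbin !rising0; ring.
have n0 : n.+1%:R != 0 :> R by rewrite pnatr_eq0.
apply: (mulfI n0); rewrite risingSM IH [RHS]mulrCA cbinSM -(natr1 n); by field.
Qed.

Lemma bernoulli_le x n : 0 <= x -> x <= 1 -> 1 - n%:R * x <= (1 - x) ^+ n.
Proof.
move=> x0 x1; elim: n => [|n IH]; first by rewrite expr0; lra.
rewrite exprSr -(natr1 n); apply: (@le_trans _ _ ((1 - n%:R * x) * (1 - x))).
  have := ler0n R n; nra.
by rewrite ler_wpM2r// subr_ge0.
Qed.

End RisingComparison.

Section Moments.
Variables (R : realType) (p : R).
Hypotheses (p_ge0 : 0 <= p) (p_le1 : p <= 1).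
Implicit Types (phi psi : stree -> R) (t l r : stree).

Lemma tsum_mul i j phi psi :
  tsum p i (fun l => tsum p j (fun r => phi l * psi r)) = tsum p i phi * tsum p j psi.
Proof. by rewrite -tsumZr; congr tsum; apply/funext => l; rewrite tsumZ. Qed.

Definition LISsum n : R := tsum p n (fun t => (LIS t)%:R).
Definition LISsqsum n : R := tsum p n (fun t => (LIS t)%:R ^+ 2).

Lemma LISsum_ge0 n : 0 <= LISsum n.
Proof. exact: tsum_ge0. Qed.

(** The square of a sum has a cross term, with probability p; the square of a maximum is at most the
    sum of the squares and has none. *)
Lemma LISsqsum_le_conv n : LISsqsum n <=
  (1 / 4 * delta R 1 n + 2 * p * conv LISsum LISsum n) + 2 * conv (catalan R) LISsqsum n.
Proof.
rewrite /LISsqsum tsumE LIS_leaf expr1n mulr1 -addrA lerD//.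
  by rewrite /delta mul1r [leRHS]mulrC.
have -> : 2 * p * conv LISsum LISsum n + 2 * conv (catalan R) LISsqsum n =
  \sum_(i < n.+1) (LISsqsum i * catalan R (n - i) + catalan R i * LISsqsum (n - i) +
    2 * p * (LISsum i * LISsum (n - i))).
  rewrite !big_split /= -mulr_sumr -/(conv LISsum LISsum n) -/(conv (catalan R) LISsqsum n).
  by rewrite -/(conv LISsqsum (catalan R) n) (convC LISsqsum); ring.
apply: ler_sum => i _.
rewrite -!(@tsum_one R p)// /LISsqsum /LISsum -!tsum_mul -!tsumZ -!tsumD.
apply: tsum_le => // l _; rewrite -!tsumZ -!tsumD; apply: tsum_le => // r _.
rewrite /coin !LIS_node !mulr1 !mul1r natrD.
have q0 : 0 <= 1 - p by rewrite subr_ge0.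
have : (maxn (LIS l) (LIS r))%:R ^+ 2 <= (LIS l)%:R ^+ 2 + (LIS r)%:R ^+ 2 :> R.
  rewrite /maxn; case: ifP => _; [rewrite lerDr|rewrite lerDl]; exact: sqr_ge0.
nra.
Qed.

(** The resolvent (1 - x)^(-1/2) times the square of (1 - x)^(-s) gives the exponent 2s + 1/2. A
    bound up to size [n] suffices at [n + 1], since both parts of a split are smaller; this is what
    permits the induction in [LISsum_growth]. *)
Lemma LISsqsum_le s x n : 0 < s -> 0 <= x ->
  (forall i, (i <= n)%N -> LISsum i <= x * rising s i) ->
  LISsqsum n.+1 <= cbin R n / 4 + 2 * p * x ^+ 2 * rising (2 * s + 1 / 2) n.+1.
Proof.
move=> s0 x0 H.
apply: le_trans (@resolvent_le R (catalan R) (cbin R) (catalan0 R) (@cbin_resolvent R) (@catalan_ge0 R)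
  LISsqsum _ n.+1 (fun k _ => LISsqsum_le_conv k) n.+1 (leqnn _)) _.
rewrite convDr convZr lerD//.
  by rewrite convC conv_delta subSS subn0 /= mulrC mulrA mulr1.
have -> : 2 * s + 1 / 2 = 1 / 2 + (s + s) by ring.
rewrite -conv_rising -convZr; apply: ler_conv => [i|k kn]; first exact: cbin_ge0.
rewrite -conv_rising -[leRHS]mulrA ler_wpM2l ?mulr_ge0// expr2 -mulrA -convZl -convZr.
apply: ler_sum => i _; have ik := ltn_ord i.
have r0 j : 0 <= x * rising s j by rewrite mulr_ge0// ltW// rising_gt0.
have [E|ne] := eqVneq (nat_of_ord i) n.+1.
  have -> : (k - i)%N = 0%N by lia.
  by rewrite /LISsum tsum0 mulr0; apply: mulr_ge0.
have [E|ne'] := eqVneq (k - i)%N n.+1.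
  have -> : nat_of_ord i = 0%N by lia.
  by rewrite /LISsum tsum0 mul0r; apply: mulr_ge0.
by apply: ler_pM; rewrite ?LISsum_ge0//; apply: H; lia.
Qed.

Lemma LISsum_sqr_le n : LISsum n ^+ 2 <= catalan R n * LISsqsum n.
Proof.
case: n => [|n]; first by rewrite /LISsum tsum0 expr0n catalan0 mul0r.
have c0 := catalan_gt0 R (ltn0Sn n).
have : 0 <= tsum p n.+1 (fun t => (catalan R n.+1 * (LIS t)%:R - LISsum n.+1) ^+ 2).
  by apply: tsum_ge0 => // t _; exact: sqr_ge0.
have E S : tsum p n.+1 (fun t => (catalan R n.+1 * (LIS t)%:R - S) ^+ 2) =
    catalan R n.+1 ^+ 2 * LISsqsum n.+1 - 2 * catalan R n.+1 * S * LISsum n.+1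
    + S ^+ 2 * tsum p n.+1 (fun=> 1).
  rewrite /LISsqsum /LISsum -!tsumZ -tsumB -tsumD; congr tsum; apply/funext => t; ring.
rewrite E tsum_one// (_ : _ + _ = catalan R n.+1 * (catalan R n.+1 * LISsqsum n.+1 - LISsum n.+1 ^+ 2)).
  by rewrite pmulr_rge0// subr_ge0.
ring.
Qed.

Lemma LISsqsum_growth s x : 0 < s -> 0 <= x ->
  (forall n, LISsum n <= x * rising s n) ->
  exists2 C, 0 < C & forall n, catalan R n * LISsqsum n <= C * rising s n ^+ 2.
Proof.
move=> s0 x0 H.
pose a := 2 * catalan R 1 * rising (2 * s + 1 / 2) 1 / rising s 1 ^+ 2.
have r1 : 0 < rising s 1 ^+ 2 by rewrite exprn_gt0// rising_gt0.
have r1' : 0 < rising (2 * s + 1 / 2) 1 by rewrite rising_gt0//; lra.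
have a0 : 0 < a by rewrite divr_gt0// !mulr_gt0// catalan_gt0.
have C1 : 0 < (4 * s ^+ 2)^-1 / 4 by rewrite divr_gt0// invr_gt0 mulr_gt0 ?exprn_gt0.
have C2 : 0 <= p * x ^+ 2 * a.
  by apply: mulr_ge0; [apply: mulr_ge0; rewrite ?sqr_ge0|exact: ltW].
exists ((4 * s ^+ 2)^-1 / 4 + p * x ^+ 2 * a); first by lra.
case=> [|n]; first by rewrite catalan0 mul0r mulr_ge0 ?sqr_ge0//; lra.
apply: le_trans (ler_wpM2l (catalan_ge0 R n.+1) (LISsqsum_le s0 x0 (fun i _ => H i))) _.
rewrite mulrDr [leRHS]mulrDl lerD//; first by rewrite mulrA [leRHS]mulrAC ler_wpM2r// catalan_cbin_le.
have -> : catalan R n.+1 * (2 * p * x ^+ 2 * rising (2 * s + 1 / 2) n.+1) =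
  p * x ^+ 2 * (2 * catalan R n.+1 * rising (2 * s + 1 / 2) n.+1) by ring.
rewrite -[leRHS]mulrA ler_wpM2l ?mulr_ge0 ?sqr_ge0//.
by apply: (@catalan_rising_le _ _ _ 1) => //; rewrite /a divfK// gt_eqF.
Qed.

(* With [S n <= x * rising s n], Cauchy-Schwarz and the second moment recursion
   return the same bound multiplied by a factor that tends to [sqrt p < 1] as
   [s --> 1 / 2] and [n --> oo]. *)
Lemma LISsum_growth : p < 1 ->
  exists s x : R, [/\ 0 < s, s < 1 / 2, 0 < x & forall n, LISsum n <= x * rising s n].
Proof.
move=> p1.
(* At s = 1/2 the induction step multiplies the squared bound by [p (2N + 1) / (2N - 1)], the [q]
   below, apart from an additive constant. *)
have [N N0 HN] : exists2 N, (0 < N)%N & p * (2 * N%:R + 1) < 2 * N%:R - 1.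
  have q0 : 0 < 1 - p by rewrite subr_gt0.
  have := archi_boundP (ltW (divr_gt0 (ltr0Sn R 1) q0)); set N := Num.bound _ => HN.
  exists N.+1 => //; rewrite -natr1; move: HN; rewrite ltr_pdivrMr//.
  have := ler0n R N; nra.
have Nr : 1 <= N%:R :> R by rewrite ler1n.
pose D : R := 2 * N%:R - 1; pose q := p * (2 * N%:R + 1) / D.
have D0 : 0 < D by rewrite /D; lra.
have q1 : q < 1 by rewrite /q ltr_pdivrMr// mul1r.
have q0 : 0 <= q by rewrite /q divr_ge0 ?mulr_ge0//; lra.
(* Bernoulli then gives (1 - e)^(2N) >= (1 + q) / 2, so replacing s = 1/2 by (1 - e) / 2 raises the
   factor [q] to at most [b = 2q / (1 + q) < 1]. *)
pose e := (1 - q) / (4 * N%:R).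
have e0 : 0 < e by rewrite /e divr_gt0//; lra.
have eN : 4 * N%:R * e = 1 - q by rewrite /e mulrC divfK// gt_eqF//; lra.
have e1 : e < 1 / 2 by nra.
pose s := (1 - e) / 2.
have s0 : 0 < s by rewrite /s; lra.
have s1 : s < 1 / 2 by rewrite /s; lra.
have rs n : 0 < rising s n by exact: rising_gt0.
pose y := 2 * catalan R N * rising (2 * s + 1 / 2) N.
pose a := y / rising s N ^+ 2; pose b := 2 * q / (1 + q).
have rsN : 0 < rising s N ^+ 2 by rewrite exprn_gt0.
have b1 : b < 1 by rewrite /b ltr_pdivrMr; lra.
have pab : p * a <= b.
  rewrite /a mulrA ler_pdivrMr//.
  apply: (@le_trans _ _ (q * cbin R N ^+ 2)).
    have -> : q * cbin R N ^+ 2 = p * (2 * catalan R N * rising (3 / 2) N).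
      rewrite rising_three_half /q.
      by rewrite expr2 {1}(cbinE R N0) -/D; field; rewrite gt_eqF.
    rewrite ler_wpM2l// /y ler_wpM2l ?mulr_ge0 ?catalan_ge0// rising_le//; lra.
  have -> : q = b * ((1 + q) / 2) by rewrite /b; field; rewrite gt_eqF//; lra.
  have b0 : 0 <= b by rewrite /b divr_ge0//; lra.
  rewrite -mulrA ler_wpM2l//.
  have H : (2 * s) ^+ N * cbin R N <= rising s N by apply: rising_half_le => //; lra.
  apply: (@le_trans _ _ (((2 * s) ^+ N * cbin R N) ^+ 2)).
    rewrite exprMn -exprM ler_wpM2r ?sqr_ge0//.
    have -> : 2 * s = 1 - e by rewrite /s; field.
    apply: le_trans (bernoulli_le (N * 2) (ltW e0) _); last by lra.
    by rewrite natrM; lra.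
  have h0 : 0 <= (2 * s) ^+ N * cbin R N.
    by apply: mulr_ge0; [apply: exprn_ge0; lra|exact: cbin_ge0].
  by rewrite ler_sqr ?nnegrE// ltW.
pose C := (4 * s ^+ 2)^-1 / 4.
have C0 : 0 < C by rewrite divr_gt0// invr_gt0 mulr_gt0 ?exprn_gt0.
(* The sum covers the sizes below [N]; the rest ensures [x >= 1] and [C <= (1 - b) x], so that
   [C + b x^2 <= x^2]. *)
pose x := \sum_(k < N) (LISsum k / rising s k) + (1 + C / (1 - b)).
have xs0 : 0 <= \sum_(k < N) (LISsum k / rising s k).
  by apply: sumr_ge0 => k _; rewrite divr_ge0 ?LISsum_ge0// ltW.
have Cb : 0 <= C / (1 - b) by rewrite divr_ge0//; lra.
have x1 : 1 <= x by rewrite /x; lra.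
exists s, x; split => //; first by lra.
elim/ltn_ind => n IH; have [nN|Nn] := ltnP n N.
  rewrite -ler_pdivrMr// /x (bigD1 (Ordinal nN))//= -!addrA lerDl addr_ge0//; last by lra.
  by apply: sumr_ge0 => k _; rewrite divr_ge0 ?LISsum_ge0// ltW.
rewrite -ler_sqr ?nnegrE ?LISsum_ge0//; last by rewrite mulr_ge0 1?ltW//; lra.
apply: le_trans (LISsum_sqr_le n) _.
have : (0 < N <= n)%N by rewrite N0.
case: n IH Nn => [|n] IH Nn Nn'; first by case/andP: Nn' => H; rewrite leqNgt H.
have H := @LISsqsum_le s x n s0 (ltac:(lra)) (fun i Hi => IH i Hi).
apply: le_trans (ler_wpM2l (catalan_ge0 R n.+1) H) _.
have Ha : 2 * catalan R n.+1 * rising (2 * s + 1 / 2) n.+1 <= a * rising s n.+1 ^+ 2.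
  by apply: (@catalan_rising_le _ _ _ N) => //; rewrite /a divfK// gt_eqF.
have Hc : catalan R n.+1 * (cbin R n / 4) <= C * rising s n.+1 ^+ 2.
  by rewrite mulrA /C [leRHS]mulrAC ler_wpM2r// catalan_cbin_le.
rewrite mulrDr.
have -> : catalan R n.+1 * (2 * p * x ^+ 2 * rising (2 * s + 1 / 2) n.+1) =
  p * x ^+ 2 * (2 * catalan R n.+1 * rising (2 * s + 1 / 2) n.+1) by ring.
apply: le_trans (lerD Hc (ler_wpM2l _ Ha)) _; first by rewrite mulr_ge0 ?sqr_ge0.
have -> : C * rising s n.+1 ^+ 2 + p * x ^+ 2 * (a * rising s n.+1 ^+ 2) =
  (C + (p * a) * x ^+ 2) * rising s n.+1 ^+ 2 by ring.
rewrite exprMn ler_wpM2r ?sqr_ge0//.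
have Cx : C <= (1 - b) * x.
  rewrite mulrC -ler_pdivrMr; last by lra.
  by rewrite /x; lra.
have x2 : x <= x ^+ 2 by rewrite expr2 ler_peMl//; lra.
apply: (@le_trans _ _ ((1 - b) * x ^+ 2 + b * x ^+ 2)); last by lra.
apply: lerD; last by rewrite ler_wpM2r ?sqr_ge0.
apply: (le_trans Cx); rewrite ler_wpM2l//; lra.
Qed.

End Moments.

(** * The lower bound on the growth *)

(* The number of pairs (leaf, [+] vertex above it), each weighted by the [LIS] of
   the subtree hanging from that vertex on the other side. *)
Fixpoint hanging (t : stree) : nat :=
  match t with
  | Leaf => 0
  | Node s l r =>
      hanging l + hanging r + s * (leaves l * LIS r + leaves r * LIS l)
  end.

(** For one fixed leaf, optimal positive subtrees hanging from its [+] ancestors meet only at such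
    ancestors, so together they form a positive subtree and their sizes add up to at most
    [LIS t]. *)
Lemma hanging_le t : (hanging t <= leaves t * LIS t)%N.
Proof.
elim: t => [|s l Hl r Hr] //=; rewrite LIS_node.
case: s; rewrite ?mul0n ?mul1n ?addn0 mulnDl ?mulnDr; first by lia.
by apply: leq_add; [apply: leq_trans Hl _|apply: leq_trans Hr _];
  rewrite leq_mul// ?leq_maxl ?leq_maxr.
Qed.

Section LowerGrowth.
Variables (R : realType) (p : R).
Hypotheses (p_ge0 : 0 <= p) (p_le1 : p <= 1).

(** The series of [k catalan k] is x (1 - x)^(-1/2) / 4; one more factor (1 - x)^(-1/2) leaves x /
    (4 (1 - x)). Hence the prefix sums in [tsum_hanging]. *)
Lemma conv_cbin_leaves n : (0 < n)%N ->
  conv (cbin R) (fun k => k%:R * catalan R k) n = 1 / 4.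
Proof.
move=> n0.
have E k : k%:R * catalan R k = conv (delta R 1) (fun j => cbin R j / 4) k.
  by rewrite conv_delta; case: k => [|k]; rewrite ?catalan0 ?mulr0// subn1 catalan_pred.
rewrite (@eq_conv _ _ (cbin R) _ (conv (delta R 1) (fun j => cbin R j / 4)))//.
rewrite convA -(@eq_conv _ (conv (delta R 1) (cbin R)) _ (fun j => cbin R j / 4) _ n); last 2 first.
- by move=> i _; rewrite convC.
- by [].
rewrite -convA conv_delta n0.
have -> : conv (cbin R) (fun j => cbin R j / 4) (n - 1)%N = 4^-1 * conv (cbin R) (cbin R) (n - 1)%N.
  by rewrite -convZr; apply: eq_bigr => i _; congr (_ * _); rewrite mulrC.
rewrite conv_rising (_ : 1 / 2 + 1 / 2 = 1); last by field.
by rewrite rising_one mulr1 mul1r.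
Qed.

Lemma tsum_hanging n :
  tsum p n (fun t => (hanging t)%:R) = p / 2 * \sum_(j < n) LISsum p j.
Proof.
pose y n := 2 * p * conv (fun k => k%:R * catalan R k) (LISsum p) n.
have E k : tsum p k (fun t => (hanging t)%:R) =
    y k + 2 * conv (catalan R) (fun k => tsum p k (fun t => (hanging t)%:R)) k.
  rewrite tsumE mulr0 add0r /y.
  set X := fun k => tsum p k (fun t => (hanging t)%:R).
  pose L k : R := k%:R * catalan R k.
  have -> : 2 * p * conv L (LISsum p) k + 2 * conv (catalan R) X k =
    \sum_(i < k.+1) (X i * catalan R (k - i) + catalan R i * X (k - i)%N +
      p * (L i * LISsum p (k - i) + LISsum p i * L (k - i)%N)).
    rewrite big_split -mulr_sumr !big_split /=.
    rewrite -/(conv X (catalan R) k) -/(conv (catalan R) X k) -/(conv L (LISsum p) k).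
    rewrite -/(conv (LISsum p) L k) (convC X) (convC (LISsum p)); ring.
  apply: eq_bigr => i _.
  have LE j : L j = tsum p j (fun t => (leaves t)%:R).
    rewrite /L -(@tsum_one R p)// -tsumZ; apply: eq_tsum => t ->; exact: mulr1.
  rewrite !LE /X /LISsum -!(@tsum_one R p)// -!tsum_mul -!tsumD -tsumZ -!tsumD.
  congr tsum; apply/funext => l; rewrite -!tsumD -tsumZ -!tsumD; congr tsum.
  apply/funext => r; rewrite /coin /= mul0n mul1n addn0 !natrD !natrM; ring.
rewrite (@resolvent_eq R (catalan R) (cbin R) (catalan0 R) (@cbin_resolvent R) _ y n (fun k _ => E k) n (leqnn n)).
rewrite convZr convA.
transitivity (2 * p * \sum_(j < n) (1 / 4 * LISsum p j)); last by rewrite -mulr_sumr; field.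
congr (_ * _); rewrite convC {1}/conv big_ord_recr /= subnn.
rewrite [X in _ + X](_ : _ = 0) ?addr0; last by rewrite /conv big_ord1 mul0r mulr0 mulr0.
apply: eq_bigr => j _; rewrite conv_cbin_leaves ?subn_gt0//; exact: mulrC.
Qed.

Lemma LISsum_recl n : p / 2 * \sum_(j < n) LISsum p j <= n%:R * LISsum p n.
Proof.
rewrite -tsum_hanging /LISsum -tsumZ; apply: tsum_le => // t <-.
by rewrite -natrM ler_nat hanging_le.
Qed.

Lemma LISsum1 : LISsum p 1 = 1 / 4.
Proof.
rewrite -(catalan1 R) -(@tsum_one R p)//; apply: eq_tsum => t /leaves_eq1 ->.
by rewrite LIS_leaf.
Qed.

Lemma rising_succ (s : R) n : n.+1%:R * rising s n.+1 = s * rising (1 + s) n.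
Proof.
elim: n => [|n IH]; first by rewrite risingS !rising0; field.
have n0 : n.+1%:R != 0 :> R by rewrite pnatr_eq0.
apply: (mulfI n0); rewrite risingSM [RHS]mulrCA risingSM [LHS]mulrCA IH -(natr1 n); ring.
Qed.

(** The prefix sums satisfy n G_n >= (n + p/2) G_(n-1), which is an equality for the coefficients of
    (1 - x)^(-1 - p/2). The constant comes from the start, (1 + p/2) / 6 <= 1/4. *)
Lemma LISsum_ge n : (0 < n)%N -> 6^-1 * rising (p / 2) n <= LISsum p n.
Proof.
have H k : 6^-1 * rising (1 + p / 2) k.+1 <= \sum_(j < k.+2) LISsum p j.
  elim: k => [|k IH].
    rewrite !big_ord_recr big_ord0 /= {1}/LISsum tsum0 LISsum1 risingS rising0 !addr0 divr1 ?add0r ?mul1r; move: (p_le1); lra.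
  have k0 : 0 < k.+2%:R :> R by [].
  rewrite -(ler_pM2l k0) mulrCA risingSM big_ord_recr /= mulrDr.
  have H := LISsum_recl k.+2; set g := \sum_(j < _) _ in IH H *.
  apply: (@le_trans _ _ ((1 + p / 2 + k.+1%:R) * g)).
    rewrite [leLHS]mulrCA ler_wpM2l// !addr_ge0// divr_ge0//.
  have -> : (1 + p / 2 + k.+1%:R) * g = k.+2%:R * g + p / 2 * g.
    by rewrite -(natr1 k.+1); ring.
  by rewrite lerD2l.
case: n => // -[_|n _].
  by rewrite LISsum1 risingS rising0 addr0 divr1 mul1r; move: (p_le1); lra.
have n0 : 0 < n.+2%:R :> R by [].
rewrite -(ler_pM2l n0) mulrCA rising_succ; apply: le_trans _ (LISsum_recl n.+2).
by rewrite mulrCA ler_wpM2l ?divr_ge0.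
Qed.

End LowerGrowth.

(** * Repeated trials *)

Section Amplification.
Variables (R : realType) (p : R).
Hypotheses (p_ge0 : 0 <= p) (p_le1 : p <= 1).
Variables (P : stree -> bool) (a : nat) (rho : R).
Hypothesis P_hereditary : forall s l r, P l || P r -> P (Node s l r).
Hypothesis a_gt0 : (0 < a)%N.
Hypothesis rho_ge0 : 0 <= rho.
Hypothesis rho_le1 : rho <= 1.
Hypothesis P_window : forall i, (a <= i < a + a)%N ->
  rho * catalan R i <= tsum p i (fun t => (P t)%:R).

(* Every tree with fewer than [2a] leaves avoids [P], so the generating function
   [D] of this class satisfies [D = x + D^2 - G] with an explicit [G]. *)
Fixpoint avoids (t : stree) : bool :=
  match t with
  | Leaf => true
  | Node _ l r =>
      if (leaves l < a + a)%N && (leaves r < a + a)%N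
      then ~~ [&& (a <= leaves l)%N, (a <= leaves r)%N & P l]
      else avoids l && avoids r
  end.

Let d n : R := tsum p n (fun t => (avoids t)%:R).

Lemma avoids_of_not t : ~~ P t -> avoids t.
Proof.
elim: t => //= s l IHl r IHr Pt.
have /norP[Pl Pr] : ~~ (P l || P r) by apply: contra Pt; exact: P_hereditary.
by case: ifP => _; rewrite ?(negbTE Pl) ?andbF// IHl// IHr.
Qed.

Lemma avoids_small t : (leaves t < a + a)%N -> avoids t.
Proof.
case: t => //= s l r tn; have l0 := leaves_gt0 l; have r0 := leaves_gt0 r.
have -> : (leaves l < a + a)%N by move: tn; clear -l0; lia.
have -> : (leaves r < a + a)%N by move: tn; clear -l0; lia.
rewrite /= andbA; apply/negP => /andP[/andP[H1 H2] _].
by move: tn; rewrite ltnNge leq_add.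
Qed.

Let d_ge0 n : 0 <= d n. Proof. exact: tsum_ge0. Qed.

Let d_le n : d n <= catalan R n.
Proof. by rewrite -(@tsum_one R p)//; apply: tsum_le => // t _; case: avoids. Qed.

Let d_small n : (n < a + a)%N -> d n = catalan R n.
Proof.
by move=> na; rewrite -(@tsum_one R p)//; apply: eq_tsum => t tn; rewrite avoids_small// tn.
Qed.

(** A split loses mass only when both parts lie in the window from [a] to [2a]: the left part is
    then an unrestricted tree, which must fail [P]. Elsewhere the indicator factorizes or is bounded
    by 1. *)
Let d_rec n : d n <= (1 / 4 * delta R 1 n + conv d d n)
  - rho * conv (catalan_window R a) (catalan_window R a) n.
Proof.
rewrite {1}/d tsumE mulr1 -addrA lerD//; first by rewrite /delta mul1r mulrC.
rewrite mulr_sumr -sumrB; apply: ler_sum => i _.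
set j := (n - i)%N.
have coinE l r : coin p (fun t => (avoids t)%:R) l r = (avoids (Node true l r))%:R.
  by rewrite /coin /=; ring.
have coinE' : (fun l => tsum p j (coin p (fun t => (avoids t)%:R) l)) =
  (fun l => tsum p j (fun r => (avoids (Node true l r))%:R)).
  by apply/funext => l; congr tsum; apply/funext => r; rewrite coinE.
rewrite coinE'.
have [/andP[ia ja]|/negP big] := boolP ((i < a + a)%N && (j < a + a)%N); last first.
  have -> : catalan_window R a i * catalan_window R a j = 0.
    by rewrite /catalan_window; case: ifP => [/andP[_ Hi]|_]; case: ifP => [/andP[_ Hj]|_];
      rewrite ?mul0r ?mulr0//; case: big; rewrite Hi.
  rewrite mulr0 subr0 /d -tsum_mul; apply: tsum_le => // l li; apply: tsum_le => // r rj.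
  rewrite /= li rj; move/negP: big => /negbTE ->.
  by rewrite -mulnb natrM.
rewrite !d_small//.
have [/andP[ia' ja']|/negP nwin] := boolP ((a <= i)%N && (a <= j)%N); last first.
  have -> : catalan_window R a i * catalan_window R a j = 0.
    by rewrite /catalan_window; case: ifP => [/andP[Hi _]|_]; case: ifP => [/andP[Hj _]|_];
      rewrite ?mul0r ?mulr0//; case: nwin; rewrite Hi.
  rewrite mulr0 subr0 -!(@tsum_one R p)// -tsum_mul.
  by apply: tsum_le => // l li; apply: tsum_le => // r rj; rewrite mulr1; case: avoids.
rewrite /catalan_window ia' ja' ia ja /=.
apply: (@le_trans _ _ (tsum p i (fun l => tsum p j (fun r => (~~ P l)%:R * 1)))).
  apply: tsum_le => // l li; apply: tsum_le => // r rj.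
  by rewrite /= li rj ia ja ia' ja' mulr1.
rewrite tsum_mul tsum_one//.
have -> : tsum p i (fun l => (~~ P l)%:R) = catalan R i - tsum p i (fun t => (P t)%:R).
  rewrite -(@tsum_one R p)// -tsumB; congr tsum; apply/funext => t.
  by case: (P t); rewrite ?subrr ?subr0.
rewrite mulrA -mulrBl ler_wpM2r ?catalan_ge0// lerD2l lerN2.
by apply: P_window; rewrite ia'.
Qed.

(** Chosen so that rho / (512 a) = eta / 4: the loss from the windows pays exactly for raising the
    leaf term from 1/4 to (1 + eta) / 4. *)
Let eta : R := rho / (128 * a%:R).

Let ar : 1 <= a%:R :> R. Proof. by rewrite ler1n. Qed.

Let eta_ge0 : 0 <= eta.
Proof. by rewrite /eta divr_ge0// mulr_ge0. Qed.

Let eta_a : 128 * a%:R * eta = rho.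
Proof. by rewrite /eta mulrC divfK// gt_eqF// mulr_gt0// ltr0n. Qed.

Lemma exprD1_le (x : R) n : 0 <= x -> 2 * n%:R * x <= 1 ->
  (1 + x) ^+ n <= 1 + 2 * n%:R * x.
Proof.
move=> x0; elim: n => [|n IH] H; first by rewrite expr0; lra.
have nr := ler0n R n; rewrite -(natr1 n) in H *.
have H' : 2 * n%:R * x <= 1 by nra.
rewrite exprSr; apply: (@le_trans _ _ ((1 + 2 * n%:R * x) * (1 + x))); last by nra.
by rewrite ler_wpM2r ?IH//; lra.
Qed.

(* A partial sum of [D] at [(1 + eta) / 4]: the recursion keeps it below the
   critical value [1 / 2]. *)
Let mass N : R := \sum_(n < N.+1) d n * (1 + eta) ^+ n.

(** For small [N] the window loss is not yet fully available. Instead, the Catalan sum stays below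
    1/2 by [cbin N / 2], which exceeds the cost [eta (2N + 1) cbin N] of the tilt. *)
Let mass_small N : (N <= 4 * a)%N -> mass N <= 1 / 2.
Proof.
move=> Na.
have Nr : N%:R <= 4 * a%:R :> R by rewrite -natrM ler_nat.
have r1 := rho_le1; have e0 := eta_ge0; have ea := eta_a.
have a1 := ar; have N0 := ler0n R N.
have Ne : N%:R * eta <= 4 * a%:R * eta by rewrite ler_wpM2r.
have e1 : 2 * N%:R * eta <= 1 by lra.
have H n : n%:R * catalan R n <= cbin R n / 2.
  case: n => [|n]; first by rewrite mul0r divr_ge0 ?cbin_ge0.
  rewrite (cbinE R (ltn0Sn n)); have := catalan_ge0 R n.+1; have : 1 <= n.+1%:R :> R by rewrite ler1n.
  by set c := catalan R _; set m := n.+1%:R; nra.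
apply: (@le_trans _ _ (\sum_(n < N.+1) (catalan R n + eta * cbin R n))).
  apply: ler_sum => n _; have nN : (n <= N)%N by rewrite -ltnS.
  have nr : n%:R <= N%:R :> R by rewrite ler_nat.
  have en : 2 * n%:R * eta <= 1 by apply: le_trans e1; rewrite ler_wpM2r// ler_wpM2l.
  apply: (@le_trans _ _ (catalan R n * (1 + 2 * n%:R * eta))).
    apply: ler_pM; rewrite ?d_ge0 ?d_le ?exprD1_le// exprn_ge0//; lra.
  have := H n; have := catalan_ge0 R n; set c := catalan R n; set w := cbin R n => c0 Hn.
  by nra.
rewrite big_split -mulr_sumr /= sum_catalan sum_cbin.
have w0 := cbin_gt0 R N.
have ae : eta <= a%:R * eta by rewrite ler_peMl.
have : eta * (2 * N%:R + 1) <= 1 / 2 by lra.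
by nra.
Qed.

Let mass_le N : mass N <= 1 / 2.
Proof.
elim: N => [|N IH]; first exact: mass_small.
have [Na|Na] := leqP N.+1 (4 * a); first exact: mass_small.
have e0 := eta_ge0; pose x := 1 + eta; have x0 : 1 <= x by rewrite /x; lra.
have xn n : 1 <= x ^+ n by apply: exprn_ege1.
(* As [d 0 = 0], the convolution at [n <= N + 1] sees only sizes up to [N], so its sum is at most
   the square of [mass N]. *)
pose d' n := if (n <= N)%N then d n * x ^+ n else 0.
have d'0 n : 0 <= d' n by rewrite /d'; case: ifP => // _; rewrite mulr_ge0// ltW// (lt_le_trans ltr01).
have Ed' : \sum_(i < N.+2) d' i = mass N.
  rewrite big_ord_recr /= /d' ltnn addr0; apply: eq_bigr => i _.
  by rewrite -ltnS ltn_ord.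
have Ec n : (n <= N.+1)%N -> conv d d n * x ^+ n = conv d' d' n.
  move=> nN; rewrite /conv mulr_suml; apply: eq_bigr => i _.
  have Hi := ltn_ord i.
  rewrite /d'; case: leqP => iN; last first.
    have -> : (n - i)%N = 0%N by apply/eqP; rewrite subn_eq0 (leq_trans nN).
    by rewrite /d tsum0 mulr0 !mul0r.
  case: leqP => jN; last first.
    have -> : nat_of_ord i = 0%N.
      by apply/eqP; rewrite -leqn0 leqNgt; apply/negP => i0; move: jN nN Hi i0; clear; lia.
    by rewrite /d tsum0 !mul0r.
  have -> : x ^+ n = x ^+ i * x ^+ (n - i) by rewrite -exprD subnKC.
  by ring.
apply: (@le_trans _ _ (\sum_(n < N.+2)
    ((1 / 4 * delta R 1 n) * x ^+ n + conv d' d' n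
     - rho * conv (catalan_window R a) (catalan_window R a) n))).
  apply: ler_sum => n _; rewrite -/x -Ec; last by rewrite -ltnS.
  rewrite -mulrDl; apply: (le_trans (ler_wpM2r _ (d_rec n))); first by rewrite ltW// (lt_le_trans ltr01).
  rewrite mulrBl lerD2l lerN2 ler_peMr// mulr_ge0// conv_ge0// => k; exact: catalan_window_ge0.
rewrite sumrB big_split -mulr_sumr /=.
have -> : \sum_(n < N.+2) 1 / 4 * delta R 1 n * x ^+ n = x / 4.
  rewrite 2!big_ord_recl big1 => [|i _]; last by rewrite /delta mulr0 mul0r.
  by rewrite /delta /= mulr0 mul0r add0r addr0 expr1; field.
have H1 : \sum_(n < N.+2) conv d' d' n <= 1 / 4.
  apply: (le_trans (sum_conv_le N.+2 d'0 d'0)); rewrite Ed'.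
  have m0 : 0 <= mass N by rewrite -Ed' sumr_ge0.
  by nra.
have H2 : 1 / (512 * a%:R) <= \sum_(n < N.+2) conv (catalan_window R a) (catalan_window R a) n.
  apply: (le_trans (sum_catalan_window_sqr R a_gt0)); rewrite expr2.
  apply: sum_conv_ge => [i|i|]; try exact: catalan_window_ge0.
  by move: Na; clear; lia.
have H3 : rho * (1 / (512 * a%:R)) = eta / 4.
  by rewrite /eta; field; rewrite gt_eqF// ltr0n.
have := ler_wpM2l rho_ge0 H2; rewrite H3; rewrite /x; lra.
Qed.

(** A single term of the mass is at most 1/2, and [catalan n >= 1 / (8 n^2)]: normalizing costs only
    a polynomial factor against the exponential gain. *)
Lemma amplification n : (0 < n)%N ->
  tsum p n (fun t => (~~ P t)%:R) * (1 + rho / (128 * a%:R)) ^+ n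
    <= 4 * n%:R ^+ 2 * catalan R n.
Proof.
move=> n0; rewrite -/eta.
have xn : 0 <= (1 + eta) ^+ n by rewrite exprn_ge0// addr_ge0.
apply: (@le_trans _ _ (1 / 2)); last first.
  have := cbin_gt0 R n; have := cbin_sqr_ge R n0; have := cbinE R n0.
  have : 1 <= n%:R :> R by rewrite ler1n.
  set w := cbin R n; set c := catalan R n; set m := n%:R => m1 wc mw w0.
  have mw1 : 1 / 2 <= m * w.
    by rewrite -ler_sqr ?nnegrE//; nra.
  have : w <= 4 * m * c by have : 0 < c := catalan_gt0 R n0; nra.
  by nra.
apply: le_trans (mass_le n); rewrite /mass big_ord_recr /=.
apply: le_trans (_ : d n * (1 + eta) ^+ n <= _).
  rewrite ler_wpM2r//; apply: tsum_le => // t _; have := @avoids_of_not t.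
  by case: (P t) => //= ->.
rewrite lerDr; apply: sumr_ge0 => i _; rewrite mulr_ge0 ?d_ge0// exprn_ge0// addr_ge0//.
Qed.

End Amplification.

(** * The skeleton of minimal subtrees *)

(* The tree spanned by the minimal subtrees of [t] with at least [m] leaves,
   each of them being collapsed to a leaf. *)
Fixpoint skeleton (m : nat) (t : stree) : option stree :=
  match t with
  | Leaf => None
  | Node s l r =>
      match skeleton m l, skeleton m r with
      | Some u, Some v => Some (Node s u v)
      | Some u, None => Some u
      | None, Some v => Some v
      | None, None => if (m <= leaves l + leaves r)%N then Some Leaf else None
      end
  end.

Lemma isSome_skeleton m t : (1 < m)%N -> isSome (skeleton m t) = (m <= leaves t)%N.
Proof.
move=> m1; elim: t => [|s l Hl r Hr] /=; first by rewrite leqNgt m1.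
case: (skeleton m l) Hl => [u|] /esym Hl; case: (skeleton m r) Hr => [v|] /esym Hr /=.
- by rewrite (leq_trans Hl) ?leq_addr.
- by rewrite (leq_trans Hl) ?leq_addr.
- by rewrite (leq_trans Hr) ?leq_addl.
- by case: ifP.
Qed.

Lemma leaves_skeleton m t u : skeleton m t = Some u -> (m * leaves u <= leaves t)%N.
Proof.
elim: t u => // s l Hl r Hr u /=.
case: (skeleton m l) Hl => [u'|] Hl; case: (skeleton m r) Hr => [v'|] Hr.
- by case=> <- /=; rewrite mulnDr leq_add ?Hl ?Hr.
- by case=> <- /=; rewrite (leq_trans (Hl _ erefl)) ?leq_addr.
- by case=> <- /=; rewrite (leq_trans (Hr _ erefl)) ?leq_addl.
- by case: ifP => // H [<-]; rewrite muln1.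
Qed.

Definition lift (R : nmodType) (phi : stree -> R) (o : option stree) : R :=
  if o is Some u then phi u else 0.

Section SkeletonBound.
Variables (R : realType) (p : R).
Hypotheses (p_ge0 : 0 <= p) (p_le1 : p <= 1).
Variables (a : nat) (theta : R).
Hypothesis a_gt0 : (0 < a)%N.
Hypothesis theta_le : forall i, (a <= i)%N -> theta * catalan R i <= LISsum p i.
Implicit Types (phi : stree -> R) (l r t u v : stree).

Let m := (a + a)%N.
Local Notation sk := (skeleton m).

Let m_gt1 : (1 < m)%N. Proof. by rewrite /m; case: (a) a_gt0 => // k _; rewrite addSn addnS. Qed.

Lemma skeleton_small t n : leaves t = n -> (n < m)%N -> sk t = None.
Proof.
by move=> <- nm; have := isSome_skeleton t m_gt1; rewrite leqNgt nm; case: sk.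
Qed.

Lemma skeleton_large t n : leaves t = n -> (m <= n)%N -> exists u, sk t = Some u.
Proof.
by move=> <- nm; have := isSome_skeleton t m_gt1; rewrite nm; case: sk => // u _; exists u.
Qed.

Let lift_ge0 phi o : (forall u, 0 <= phi u) -> 0 <= lift phi o.
Proof. by case: o => /=. Qed.

Lemma coin_const (x : R) (phi : stree -> R) l r :
  (forall s, phi (Node s l r) = x) -> coin p phi l r = x.
Proof. by move=> H; rewrite /coin !H; ring. Qed.

Lemma coin_le phi psi l r :
  (forall s, phi (Node s l r) <= psi (Node s l r)) -> coin p phi l r <= coin p psi l r.
Proof. by move=> H; rewrite /coin lerD// ler_wpM2l// subr_ge0. Qed.

Lemma tsum_const n (x : R) : tsum p n (fun=> x) = x * catalan R n.
Proof. by rewrite -(@tsum_one R p)// -tsumZ; congr tsum; apply/funext => t; rewrite mulr1. Qed.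

(* The optimal positive subtree of the skeleton is chosen independently of the
   collapsed subtrees, which contribute at least [theta] leaves each on average. *)
Lemma LIS_skeleton_le n phi : (forall u, 0 <= phi u) ->
  theta * tsum p n (fun t => lift (fun u => (LIS u)%:R * phi u) (sk t)) <=
  tsum p n (fun t => (LIS t)%:R * lift phi (sk t)).
Proof.
elim/ltn_ind: n phi => n IH phi phi0.
rewrite !tsumE /= !mulr0 !add0r mulr_sumr; apply: ler_sum => i _.
have iN : (i <= n)%N by rewrite -ltnS.
have [i0|i0] := posnP i; first by rewrite i0 !tsum0 mulr0.
have [j0|j0] := posnP (n - i)%N.
  rewrite j0 tsum_fun0 => [|l]; last by rewrite tsum0.
  by rewrite tsum_fun0 ?mulr0// => l; rewrite tsum0.
have ij : (i + (n - i))%N = n by rewrite subnKC.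
have jn : (n - i < n)%N by rewrite ltn_subrL i0 (leq_trans i0 iN).
have in' : (i < n)%N by rewrite -subn_gt0.
set j := (n - i)%N in j0 ij jn *.
have [jm|mj] := ltnP j m; have [im|mi] := ltnP i m.
- have [nm|mn] := ltnP n m.
    rewrite [X in theta * X](_ : _ = 0) ?mulr0; last first.
      rewrite -(tsum_zero p i); apply: eq_tsum => l li.
      rewrite -(tsum_zero p j); apply: eq_tsum => r rj; apply: coin_const => s /=.
      by rewrite (skeleton_small li im) (skeleton_small rj jm) li rj ij leqNgt nm.
    apply: tsum_ge0 => // l _; apply: tsum_ge0 => // r _.
    by rewrite /coin addr_ge0// !mulr_ge0 ?subr_ge0// lift_ge0.
  (* This vertex is collapsed. Its children have fixed sizes of sum at least [2a] and are otherwise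
     unrestricted, so [theta_le] applies to one of size at least [a]. *)
  rewrite [X in theta * X](_ : _ = phi Leaf * catalan R j * catalan R i); last first.
    rewrite -tsum_const; apply: eq_tsum => l li.
    rewrite -tsum_const; apply: eq_tsum => r rj; apply: coin_const => s /=.
    by rewrite (skeleton_small li im) (skeleton_small rj jm) li rj ij mn /= LIS_leaf mul1r.
  have Hge (psi : stree -> stree -> R) :
    (forall l r, psi l r <= (maxn (LIS l) (LIS r))%:R) ->
    tsum p i (fun l => tsum p j (fun r => psi l r)) * phi Leaf <=
    tsum p i (fun l => tsum p j
      (fun r => coin p (fun t => (LIS t)%:R * lift phi (sk t)) l r)).
    move=> H; rewrite -tsumZr; apply: tsum_le => // l li.
    rewrite -tsumZr; apply: tsum_le => // r rj.
    rewrite -[leLHS](@coin_const _ (fun=> psi l r * phi Leaf) l r)//; apply: coin_le => s /=.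
    rewrite (skeleton_small li im) (skeleton_small rj jm) li rj ij mn /= ler_wpM2r//.
    by apply: le_trans (H l r) _; rewrite ler_nat LIS_node_maxn.
  have [ai|ia] := leqP a i.
    apply: le_trans (Hge (fun l _ => (LIS l)%:R) _); last first.
      by move=> l r; rewrite ler_nat leq_maxl.
    rewrite [X in _ <= X * _](_ : _ = LISsum p i * catalan R j); last first.
      by rewrite /LISsum -tsumZr; congr tsum; apply/funext => l; rewrite tsum_const.
    have := ler_wpM2r (mulr_ge0 (phi0 Leaf) (catalan_ge0 R j)) (theta_le ai).
    by congr (_ <= _); ring.
  have aj : (a <= j)%N.
    by rewrite leqNgt; apply/negP => ja; move: mn ia ja ij; rewrite /m; clear; lia.
  apply: le_trans (Hge (fun _ r => (LIS r)%:R) _); last first.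
    by move=> l r; rewrite ler_nat leq_maxr.
  rewrite [X in _ <= X * _](_ : _ = LISsum p j * catalan R i); last by rewrite tsum_const.
  have := ler_wpM2r (mulr_ge0 (phi0 Leaf) (catalan_ge0 R i)) (theta_le aj).
  by congr (_ <= _); ring.
- apply: (@le_trans _ _ (tsum p i (fun l => (LIS l)%:R * lift phi (sk l)) * catalan R j)).
    rewrite [X in theta * X](_ : _ = tsum p i (fun l => lift (fun u => (LIS u)%:R * phi u) (sk l)) * catalan R j).
      by rewrite mulrA ler_wpM2r ?catalan_ge0// IH.
    rewrite -tsumZr; apply: eq_tsum => l li; rewrite -tsum_const; apply: eq_tsum => r rj.
    have [u Eu] := skeleton_large li mi.
    by apply: coin_const => s /=; rewrite (skeleton_small rj jm) Eu.
  rewrite -tsumZr; apply: tsum_le => // l li; rewrite -tsum_const; apply: tsum_le => // r rj.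
  have [u Eu] := skeleton_large li mi.
  set x := _ * lift phi (sk l).
  rewrite -[leLHS](@coin_const x (fun=> x) l r)//; apply: coin_le => s /=.
  rewrite /x (skeleton_small rj jm) Eu /= ler_wpM2r// ler_nat.
  by apply: leq_trans (LIS_node_maxn s l r); rewrite leq_maxl.
- apply: (@le_trans _ _ (tsum p j (fun r => (LIS r)%:R * lift phi (sk r)) * catalan R i)).
    rewrite [X in theta * X](_ : _ = tsum p j (fun l => lift (fun u => (LIS u)%:R * phi u) (sk l)) * catalan R i).
      by rewrite mulrA ler_wpM2r ?catalan_ge0// IH.
    rewrite -tsum_const; apply: eq_tsum => l li; apply: eq_tsum => r rj.
    have [u Eu] := skeleton_large rj mj.
    by apply: coin_const => s /=; rewrite (skeleton_small li im) Eu.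
  rewrite -tsum_const; apply: tsum_le => // l li; apply: tsum_le => // r rj.
  have [u Eu] := skeleton_large rj mj.
  set x := _ * lift phi (sk r).
  rewrite -[leLHS](@coin_const x (fun=> x) l r)//; apply: coin_le => s /=.
  rewrite /x (skeleton_small li im) Eu /= ler_wpM2r// ler_nat.
  by apply: leq_trans (LIS_node_maxn s l r); rewrite leq_maxr.
(* At a [-] vertex only the side with the larger skeleton [LIS] is kept. The choice depends on the
   skeletons alone, so with one subtree fixed it is a weight on the skeleton of the other; this is
   why the lemma allows a general [phi]. *)
- pose al u v := p * phi (Node true u v) + (1 - p) * ((LIS v <= LIS u)%N%:R * phi (Node false u v)).
  pose be u v := p * phi (Node true u v) + (1 - p) * ((LIS u < LIS v)%N%:R * phi (Node false u v)).
  have al0 u v : 0 <= al u v by rewrite /al addr_ge0 ?mulr_ge0// subr_ge0.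
  have be0 u v : 0 <= be u v by rewrite /be addr_ge0 ?mulr_ge0// subr_ge0.
  pose f r u := lift (al u) (sk r); pose g l v := lift (be ^~ v) (sk l).
  have f0 r u : 0 <= f r u by apply: lift_ge0.
  have g0 l v : 0 <= g l v by apply: lift_ge0 => u; exact: be0.
  rewrite [X in theta * X](_ : _ =
    tsum p i (fun l => tsum p j (fun r => lift (fun u => (LIS u)%:R * f r u) (sk l))) +
    tsum p i (fun l => tsum p j (fun r => lift (fun v => (LIS v)%:R * g l v) (sk r)))); last first.
    rewrite -tsumD; apply: eq_tsum => l li; rewrite -tsumD; apply: eq_tsum => r rj.
    have [u Eu] := skeleton_large li mi; have [v Ev] := skeleton_large rj mj.
    rewrite /coin /= /f /g Eu Ev /= !LIS_node natrD /al /be.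
    case: leqP => uv; rewrite ?mul1r ?mul0r ?mulr0; ring.
  apply: (@le_trans _ _
    (tsum p i (fun l => tsum p j (fun r => (LIS l)%:R * lift (f r) (sk l))) +
     tsum p i (fun l => tsum p j (fun r => (LIS r)%:R * lift (g l) (sk r))))).
    rewrite mulrDr; apply: lerD.
      rewrite tsum_exchange [leRHS]tsum_exchange -tsumZ; apply: tsum_le => // r _.
      by apply: IH.
    by rewrite -tsumZ; apply: tsum_le => // l _; apply: IH.
  rewrite -tsumD; apply: tsum_le => // l li; rewrite -tsumD; apply: tsum_le => // r rj.
  have [u Eu] := skeleton_large li mi; have [v Ev] := skeleton_large rj mj.
  rewrite /coin /= /f /g Eu Ev /= !LIS_node natrD.
  have : (LIS v <= LIS u)%N%:R * (LIS l)%:R + (LIS u < LIS v)%N%:R * (LIS r)%:R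
     <= (maxn (LIS l) (LIS r))%:R :> R.
    by case: leqP => _; rewrite ?mul1r ?mul0r ?add0r ?addr0 ler_nat ?leq_maxl ?leq_maxr.
  have q0 : 0 <= (1 - p) * phi (Node false u v) by rewrite mulr_ge0// subr_ge0.
  move/(ler_wpM2r q0) => H.
  rewrite -[leRHS]addr0 -[leLHS]addr0 /al /be.
  set A := (LIS v <= LIS u)%N%:R in H *; set B := (LIS u < LIS v)%N%:R in H *.
  move: H; set M := (maxn _ _)%:R; set X := (LIS l)%:R; set Y := (LIS r)%:R; lra.
Qed.

End SkeletonBound.

(** * The law of the skeleton given its number of leaves *)

Section SkeletonLaw.
Variables (R : realType) (p : R).
Hypotheses (p_ge0 : 0 <= p) (p_le1 : p <= 1).
Variables (m N : nat).
Hypothesis m_gt1 : (1 < m)%N.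
Implicit Types (phi : stree -> R) (l r t u v : stree).

Local Notation sk := (skeleton m).

Definition small_catalan n : R := if (n < m)%N then catalan R n else 0.

(** Counts the trees that are themselves minimal: large, with two small children. *)
Definition minimal_catalan n : R := if (m <= n)%N then conv small_catalan small_catalan n else 0.

Definition small_ser : {poly R} := trunc N small_catalan.
(** The factor 4 cancels the weight 1/4 of the skeleton leaf to which a block is collapsed. *)
Definition block_ser : {poly R} := trunc N (fun n => 4 * minimal_catalan n).
(** The geometric series of 1 / (1 - 2S), exact up to degree [N] because S has no constant term; the
    2 is the side of the small child. *)
Definition chain_ser : {poly R} := \sum_(k < N.+1) (2 *: small_ser) ^+ k.

(* The [2k - 1] edges of a skeleton with [k] leaves, the root edge included, are
   chains of vertices whose other child is small. *)
Definition skeleton_ser k : {poly R} := block_ser ^+ k * chain_ser ^+ (2 * k - 1).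

Lemma small_catalan_ge0 n : 0 <= small_catalan n.
Proof. by rewrite /small_catalan; case: ifP; rewrite ?catalan_ge0. Qed.

Lemma minimal_catalan_ge0 n : 0 <= minimal_catalan n.
Proof. by rewrite /minimal_catalan; case: ifP; rewrite ?conv_ge0//; exact: small_catalan_ge0. Qed.

Lemma skeleton_ser_ge0 k n : 0 <= (skeleton_ser k)`_n.
Proof.
have M (P Q : {poly R}) : (forall i, 0 <= P`_i) -> (forall i, 0 <= Q`_i) ->
    forall i, 0 <= (P * Q)`_i.
  by move=> P0 Q0 i; rewrite coefM sumr_ge0// => j _; rewrite mulr_ge0.
have XP (P : {poly R}) j : (forall i, 0 <= P`_i) -> forall i, 0 <= (P ^+ j)`_i.
  move=> P0; elim: j => [|j IH] i; first by rewrite expr0 coef1.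
  by rewrite exprS M.
have T (x : nat -> R) i : (forall i, 0 <= x i) -> 0 <= (trunc N x)`_i.
  by move=> x0; rewrite coef_poly; case: ifP.
apply: M; apply: (XP) => i.
  by apply: T => j; rewrite mulr_ge0// minimal_catalan_ge0.
rewrite coef_sum sumr_ge0// => j _; apply: (XP) => h.
by rewrite coefZ mulr_ge0//; apply: T; exact: small_catalan_ge0.
Qed.

Lemma mulX_trunc (x : nat -> R) : x 0%N = 0 -> exists P : {poly R}, trunc N x = 'X * P.
Proof.
move=> x0; exists (\poly_(i < N) x i.+1); apply/polyP => i.
by rewrite coefXM !coef_poly; case: i => [|i] //=; rewrite x0 if_same.
Qed.

(** [chain_ser * (1 - 2S)] differs from 1 by a multiple of ['X^(N + 1)], which does not affect the
    coefficients up to [N]. *)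
Lemma chain_serP (x y : nat -> R) :
  (forall n, (n <= N)%N -> x n = y n + 2 * conv small_catalan x n) ->
  forall n, (n <= N)%N -> x n = (chain_ser * trunc N y)`_n.
Proof.
move=> xE n nN.
have [P EP] : exists P : {poly R}, small_ser = 'X * P.
  by apply: mulX_trunc; rewrite /small_catalan catalan0 if_same.
have E : chain_ser * (1 - 2 *: small_ser) = 1 - (2 *: small_ser) ^+ N.+1.
  rewrite -[in RHS]opprB subrX1 -mulNr opprB mulrC; congr (_ * _).
transitivity ((chain_ser * ((1 - 2 *: small_ser) * trunc N x))`_n).
  rewrite mulrA E mulrBl mul1r coefB coef_trunc// EP scalerAr exprMn -mulrA coefXnM ltnS nN.
  by rewrite subr0.
apply: eq_coef_mulr nN => k kN.
rewrite mulrBl mul1r -scalerAl coefB coefZ coef_trunc_mul// !coef_trunc// xE//.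
by rewrite addrK.
Qed.

Let phi_sum n phi : R := tsum p n (fun t => lift phi (sk t)).

Lemma tsum_small i : tsum p i (fun t => (leaves t < m)%N%:R) = small_catalan i.
Proof.
rewrite -[RHS](_ : (i < m)%N%:R * catalan R i = _); last first.
  by rewrite /small_catalan; case: ltnP; rewrite ?mul1r ?mul0r.
by rewrite -(@tsum_one R p)// -tsumZ; apply: eq_tsum => t ->; rewrite mulr1.
Qed.

(** The three ways a root can contribute: both children small (a block), both large (a skeleton
    vertex), or exactly one large, where the root is contracted and its sign averages out. *)
Let phi_sumE n phi : phi_sum n phi =
  (minimal_catalan n * phi Leaf +
   \sum_(i < n.+1) phi_sum i (fun u => phi_sum (n - i) (coin p phi u)))
  + 2 * conv small_catalan (phi_sum ^~ phi) n.
Proof.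
rewrite {1}/phi_sum tsumE mulr0 add0r.
have -> : 2 * conv small_catalan (phi_sum ^~ phi) n =
  \sum_(i < n.+1) (small_catalan i * phi_sum (n - i) phi + phi_sum i phi * small_catalan (n - i)).
  rewrite big_split /= -/(conv small_catalan (phi_sum^~ phi) n).
  by rewrite -/(conv (phi_sum^~ phi) small_catalan n) (convC (phi_sum ^~ phi)); ring.
have -> : minimal_catalan n * phi Leaf =
  \sum_(i < n.+1) (m <= n)%N%:R * phi Leaf * (small_catalan i * small_catalan (n - i)).
  rewrite /minimal_catalan -mulr_sumr /conv.
  by case: ifP; rewrite ?mul1r ?mul0r// mulrC.
rewrite -!big_split; apply: eq_bigr => i _ /=.
have iN : (i <= n)%N by rewrite -ltnS.
have -> : phi_sum i (fun u => phi_sum (n - i) (coin p phi u)) =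
    tsum p i (fun l => tsum p (n - i) (fun r =>
      lift (fun u => lift (coin p phi u) (sk r)) (sk l))).
  rewrite /phi_sum; congr tsum; apply/funext => l; case: (sk l) => //=.
  by rewrite tsum_zero.
rewrite -!tsum_small /phi_sum -!tsum_mul -tsumZ -!tsumD.
apply: eq_tsum => l li; rewrite -tsumZ -!tsumD; apply: eq_tsum => r rj.
have nE : (leaves l + leaves r)%N = n by rewrite li rj subnKC.
have := isSome_skeleton l m_gt1; have := isSome_skeleton r m_gt1.
rewrite {1}/coin /= nE !(ltnNge _ m).
case: (sk l) => [u|] /=; case: (sk r) => [v|] /= <- <- /=; rewrite /coin.
- ring.
- ring.
- ring.
- case: ifP => _ /=; ring.
Qed.

Let phi_sum0 phi : phi_sum 0 phi = 0. Proof. exact: tsum0. Qed.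

Let phi_sum_zero n phi : (forall u, phi u = 0) -> phi_sum n phi = 0.
Proof. by move=> H; apply: tsum_fun0 => t; case: (sk t) => //=. Qed.

Let phi_sum_sum n (I : Type) (s : seq I) (F : stree -> I -> R) :
  phi_sum n (fun u => \sum_(i <- s) F u i) = \sum_(i <- s) phi_sum n (F ^~ i).
Proof.
rewrite /phi_sum -tsum_sum; congr tsum; apply/funext => t.
by case: (sk t) => //=; rewrite big1.
Qed.

Let phi_sumZr n x phi : phi_sum n (fun u => phi u * x) = phi_sum n phi * x.
Proof.
by rewrite /phi_sum -tsumZr; congr tsum; apply/funext => t; case: (sk t) => //=; rewrite mul0r.
Qed.

(** As [skeleton_ser] without the chain above the skeleton's root. *)
Definition level_ser k : {poly R} := block_ser ^+ k * chain_ser ^+ (2 * k - 2).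

Lemma skeleton_serM k1 k2 : (0 < k1)%N -> (0 < k2)%N ->
  skeleton_ser k1 * skeleton_ser k2 = level_ser (k1 + k2).
Proof.
move=> k10 k20; rewrite /skeleton_ser /level_ser mulrACA -!exprD; congr (_ * _ ^+ _).
clear -k10 k20; lia.
Qed.

Lemma chain_level k : (0 < k)%N -> chain_ser * level_ser k = skeleton_ser k.
Proof.
move=> k0; rewrite /skeleton_ser /level_ser mulrCA -exprS; congr (_ * _ ^+ _).
clear -k0; lia.
Qed.

Lemma block_serX : exists P : {poly R}, block_ser = 'X * P.
Proof.
apply: mulX_trunc; rewrite /minimal_catalan leqNgt (ltnW m_gt1) /= ?mulr0//.
Qed.

Lemma level_ser_small k n : (n < k)%N -> (level_ser k)`_n = 0.
Proof.
have [P EP] := block_serX.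
by move=> nk; rewrite /level_ser EP exprMn -mulrA coefXnM nk.
Qed.

Lemma skeleton_ser_coef0 k : (0 < k)%N -> (skeleton_ser k)`_0 = 0.
Proof.
have [P EP] := block_serX.
by move=> nk; rewrite /skeleton_ser EP exprMn -mulrA coefXnM nk.
Qed.

(* Given its number of leaves, the skeleton has the law of a random tree. *)
Lemma tsum_skeleton n phi : (n <= N)%N ->
  tsum p n (fun t => lift phi (sk t)) = \sum_(k < N.+1) tsum p k phi * (skeleton_ser k)`_n.
Proof.
rewrite -/(phi_sum n phi); elim/ltn_ind: n phi => n IH phi nN.
pose y k := minimal_catalan k * phi Leaf +
   \sum_(i < k.+1) phi_sum i (fun u => phi_sum (k - i) (coin p phi u)).
rewrite (@chain_serP _ y (fun k _ => phi_sumE k phi) n nN).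
(* [y] collects the trees whose root is kept in the skeleton, so the root chain is absent. *)
have yE k : (k <= n)%N -> y k = \sum_(K < N.+1) tsum p K phi * (level_ser K)`_k.
  move=> kn; have kN := leq_trans kn nN.
  pose c i j := tsum p i (fun u => tsum p j (coin p phi u)).
  have c0l j : c 0%N j = 0 by exact: tsum0.
  have c0r i : c i 0%N = 0 by apply: tsum_fun0 => u; exact: tsum0.
  have -> : \sum_(K < N.+1) tsum p K phi * (level_ser K)`_k =
    minimal_catalan k * phi Leaf + \sum_(K < N.+1) \sum_(i < K.+1)
      c i (K - i)%N * (level_ser (i + (K - i)))`_k.
    have -> : minimal_catalan k * phi Leaf =
      \sum_(K < N.+1) (K == 1 :> nat)%:R / 4 * phi Leaf * (level_ser K)`_k.
      have EB : (level_ser 1)`_k = 4 * minimal_catalan k.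
        by rewrite /level_ser expr1 muln1 subnn expr0 mulr1 coef_trunc.
      have [N0|N0] := posnP N.
        rewrite N0 big_ord1 !mul0r; move: kN; rewrite N0 leqn0 => /eqP ->.
        by rewrite /minimal_catalan leqNgt (ltnW m_gt1) mul0r.
      rewrite (bigD1 (inord 1 : 'I_N.+1))//= inordK// eqxx EB big1 ?addr0.
        by rewrite mulr1n; field.
      move=> i /eqP i1; case: eqP => [E|_]; last by rewrite !mul0r.
      by case: i1; apply: val_inj; rewrite /= inordK.
    rewrite -big_split; apply: eq_bigr => K _ /=; rewrite tsumE mulrDl; congr (_ + _).
    rewrite mulr_suml; apply: eq_bigr => i _; congr (_ * _`_k).
    by rewrite subnKC// -ltnS.
  congr (_ + _).
  rewrite (@sum_convE _ (fun i j => c i j * (level_ser (i + j))`_k)).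
  transitivity (\sum_(i < N.+1) \sum_(j < N.+1) c i j * (skeleton_ser i * skeleton_ser j)`_k).
    transitivity (\sum_(i < k.+1) \sum_(k1 < N.+1) \sum_(k2 < N.+1)
      c k1 k2 * ((skeleton_ser k1)`_i * (skeleton_ser k2)`_(k - i))).
      apply: eq_bigr => i _.
      have ik : (i <= k)%N by rewrite -ltnS.
      have [i0|i0] := posnP i.
        rewrite i0 phi_sum0 big1// => k1 _; rewrite big1// => k2 _.
        have [->|k10] := posnP k1; first by rewrite c0l mul0r.
        by rewrite skeleton_ser_coef0// mul0r mulr0.
      have [j0|j0] := posnP (k - i)%N.
        rewrite j0 phi_sum_zero => [|u]; last exact: phi_sum0.
        rewrite big1// => k1 _; rewrite big1// => k2 _.
        have [->|k20] := posnP k2; first by rewrite c0r mul0r.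
        by rewrite skeleton_ser_coef0// !mulr0.
      have jn : (k - i < n)%N by rewrite (leq_trans _ kn)// ltn_subrL i0 (leq_trans i0 ik).
      have in' : (i < n)%N by rewrite (leq_trans _ kn)// -subn_gt0.
      transitivity (phi_sum i (fun u => \sum_(k2 < N.+1)
          tsum p k2 (coin p phi u) * (skeleton_ser k2)`_(k - i))).
        congr phi_sum; apply/funext => u; apply: IH => //.
        by rewrite ltnW// (leq_trans jn).
      rewrite phi_sum_sum exchange_big; apply: eq_bigr => k2 _ /=.
      rewrite phi_sumZr IH//; last by rewrite ltnW// (leq_trans in').
      rewrite mulr_suml; apply: eq_bigr => k1 _; by rewrite /c mulrA.
    rewrite exchange_big; apply: eq_bigr => k1 _; rewrite exchange_big; apply: eq_bigr => k2 _ /=.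
    by rewrite -mulr_sumr coefM.
  apply: eq_bigr => i _; rewrite [RHS]big_mkcond; apply: eq_bigr => j _.
  have [->|i0] := posnP i; first by rewrite c0l !mul0r if_same.
  have [->|j0] := posnP j; first by rewrite c0r !mul0r if_same.
  (* Each block has positive size, so more than [N] blocks cannot occur in degree [k <= N]. *)
  rewrite skeleton_serM//; case: ltnP => // Nij.
  by rewrite level_ser_small ?mulr0// (leq_ltn_trans kN).
rewrite coefM.
transitivity (\sum_(i < n.+1) \sum_(K < N.+1) tsum p K phi * (chain_ser`_i * (level_ser K)`_(n - i))).
  apply: eq_bigr => i _; have ni : (n - i <= n)%N by exact: leq_subr.
  rewrite coef_trunc ?(leq_trans ni)// yE// mulr_sumr; apply: eq_bigr => K _.
  by rewrite mulrCA.
rewrite exchange_big; apply: eq_bigr => K _ /=; rewrite -mulr_sumr -coefM.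
by have [->|K0] := posnP K; [rewrite tsum0 !mul0r|rewrite chain_level].
Qed.

End SkeletonLaw.

(** * Supermultiplicativity of the mean *)

Section Supermultiplicativity.
Variables (R : realType) (p : R).
Hypotheses (p_ge0 : 0 <= p) (p_le1 : p <= 1).

Definition meanLIS n : R := LISsum p n / catalan R n.

Lemma meanLIS_mono m n : (0 < m <= n)%N -> meanLIS m <= meanLIS n.
Proof.
by apply: (@tsum_LIS_mono R p p_ge0 p_le1 (fun k => k%:R)) => // i j; rewrite ler_nat.
Qed.

Lemma meanLIS_ge0 n : 0 <= meanLIS n.
Proof. by rewrite /meanLIS divr_ge0 ?LISsum_ge0 ?catalan_ge0. Qed.

Lemma LISsumE n : (0 < n)%N -> LISsum p n = meanLIS n * catalan R n.
Proof. by move=> n0; rewrite /meanLIS divfK// gt_eqF// catalan_gt0. Qed.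

(** The number of minimal subtrees is additive over the children, with source the event that the
    root is minimal. *)
Lemma tsum_leaves_skeleton m n : (1 < m)%N ->
  tsum p n (fun t => lift (fun u => (leaves u)%:R) (skeleton m t))
    = conv (cbin R) (minimal_catalan R m) n.
Proof.
move=> m1; pose X k := tsum p k (fun t => lift (fun u => (leaves u)%:R) (skeleton m t)) : R.
suff XE k : X k = minimal_catalan R m k + 2 * conv (catalan R) X k.
  exact: (@resolvent_eq R (catalan R) (cbin R) (catalan0 R) (@cbin_resolvent R) X _ n (fun k _ => XE k)).
rewrite {1}/X tsumE mulr0 add0r.
have -> : minimal_catalan R m k + 2 * conv (catalan R) X k =
  \sum_(i < k.+1) ((m <= k)%N%:R * (small_catalan R m i * small_catalan R m (k - i))
     + (catalan R i * X (k - i)%N + X i * catalan R (k - i))).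
  rewrite !big_split /= -mulr_sumr -/(conv (catalan R) X k) -/(conv X (catalan R) k) (convC X).
  rewrite -/(conv (small_catalan R m) (small_catalan R m) k) /minimal_catalan.
  by case: ifP => _; rewrite ?mul1r ?mul0r; ring.
apply: eq_bigr => i _; have iN : (i <= k)%N by rewrite -ltnS.
rewrite -!(@tsum_small R p) -!(@tsum_one R p)// /X -!tsum_mul -tsumZ -!tsumD.
apply: eq_tsum => l li; rewrite -tsumZ -!tsumD; apply: eq_tsum => r rj.
have nE : (leaves l + leaves r)%N = k by rewrite li rj subnKC.
have := isSome_skeleton l m1; have := isSome_skeleton r m1.
rewrite {1}/coin /= nE !(ltnNge _ m).
case: (skeleton m l) => [u|] /=; case: (skeleton m r) => [v|] /= <- <- /=; rewrite ?natrD; try ring.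
by case: ifP => _ /=; ring.
Qed.

Lemma conv_window_le a n :
  conv (catalan_window R a) (catalan_window R a) n <= minimal_catalan R (a + a) n.
Proof.
rewrite /minimal_catalan; case: leqP => an.
  apply: ler_sum => i _; apply: ler_pM; rewrite ?catalan_window_ge0//.
    rewrite /catalan_window /small_catalan; case: ifP => [/andP[_ ->]//|_].
    by case: ifP => _; rewrite ?catalan_ge0.
  rewrite /catalan_window /small_catalan; case: ifP => [/andP[_ ->]//|_].
  by case: ifP => _; rewrite ?catalan_ge0.
rewrite /conv big1// => i _; rewrite /catalan_window.
case: ifP => [/andP[ai _]|_]; last by rewrite mul0r.
case: ifP => [/andP[aj _]|_]; last by rewrite mulr0.
have ik : (i <= n)%N by rewrite -ltnS.
by exfalso; move: an ai aj ik; clear; set x := nat_of_ord i; lia.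
Qed.

(** Reverse Markov inequality in the unit n / (512 a): the number of skeleton leaves has mean at
    least 2 units and never exceeds n / (2a), which is 256 units, while [k] is at most 1 unit. *)
Lemma skeleton_large_prob a k n : (0 < a)%N -> (0 < k)%N -> (512 * a * k <= n)%N ->
  catalan R n / 256 <= tsum p n (fun t => lift (fun u => (k <= leaves u)%N%:R) (skeleton (a + a) t)).
Proof.
move=> a0 k0 nak; move EQ : (tsum _ _ _) => Q.
have m1 : (1 < a + a)%N by move: a0; clear; lia.
have n0 : (0 < n)%N by move: nak a0 k0; clear; nia.
have n4 : (a + a + (a + a) <= n.+2)%N by move: nak k0; clear; nia.
have ar : 0 < a%:R :> R by rewrite ltr0n.
have [A [A0 EA kA]] : exists A : R, [/\ 0 < A, A = 512 * a%:R & k%:R * A <= n%:R].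
  exists (512 * a%:R); split; [exact: mulr_gt0 (ltr0Sn R 511) ar|exact: erefl|].
  by rewrite mulrC -!natrM ler_nat; exact: nak.
clear nak.
have nr : 0 < n%:R :> R by rewrite ltr0n.
have c0 := catalan_gt0 R n0.
have EA2 : 2 * a%:R = A / 256 by rewrite EA; field.
have H1 : 2 * n%:R / A * catalan R n <= conv (cbin R) (minimal_catalan R (a + a)) n.
  apply: (@le_trans _ _ (cbin R n * \sum_(j < n.+1) conv (catalan_window R a) (catalan_window R a) j)).
    apply: (@le_trans _ _ (cbin R n * A^-1)).
      have n1 : 1 <= n%:R :> R by rewrite ler1n.
      rewrite (cbinE R n0) mulrAC ler_wpM2r// ?invr_ge0 ?(ltW A0)//.
      by rewrite ler_wpM2r ?(ltW c0)//; clear -n1; lra.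
    rewrite ler_wpM2l ?cbin_ge0//.
    have := sum_catalan_window_sqr R a0; rewrite -EA mul1r => H; apply: (le_trans H).
    by rewrite expr2; apply: sum_conv_ge => // i; exact: catalan_window_ge0.
  rewrite convC mulr_sumr; apply: ler_sum => j _; rewrite mulrC ler_pM//.
  - by apply: conv_ge0 => i; exact: catalan_window_ge0.
  - exact: cbin_ge0.
  - exact: conv_window_le.
  - by apply: cbin_le; rewrite leq_subr.
have A2 : 0 < A / 256 by rewrite -EA2 mulr_gt0.
have H2 : conv (cbin R) (minimal_catalan R (a + a)) n <= n%:R / (A / 256) * Q + k%:R * catalan R n.
  rewrite -(@tsum_leaves_skeleton _ n m1) -(@tsum_const R p n) -EQ -tsumZ -tsumD.
  apply: tsum_le => // t tn; case E: skeleton => [u|] /=; last by rewrite mulr0 add0r.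
  have := leaves_skeleton E; rewrite tn => Hu.
  case: leqP => ku; last by rewrite mulr0 add0r ler_nat ltnW.
  rewrite mulr1; apply: (@le_trans _ _ (n%:R / (A / 256))); last by rewrite lerDl.
  rewrite ler_pdivlMr// -EA2 -!natrM ler_nat mulnC.
  by rewrite mul2n -addnn.
have kn : k%:R <= n%:R / A by rewrite ler_pdivlMr.
have H3 : k%:R * catalan R n <= n%:R / A * catalan R n by rewrite ler_wpM2r// ltW.
have x0 : 0 < n%:R / A by exact: divr_gt0.
have H := le_trans H1 (le_trans H2 (lerD (lexx _) H3)).
have E : n%:R / (A / 256) = 256 * (n%:R / A) by field; rewrite gt_eqF.
rewrite E -!mulrA in H; clear E EA EA2 EQ A2 H1 H2 H3 kA kn.
rewrite !(mulrA n%:R A^-1) in H; move: H x0; set x := n%:R / A; set c := catalan R n; clear => H x0.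
by rewrite -(ler_pM2l x0); lra.
Qed.

Lemma meanLIS_supermul a k n : (0 < a)%N -> (0 < k)%N -> (512 * a * k <= n)%N ->
  meanLIS k * meanLIS a / 256 <= meanLIS n.
Proof.
move=> a0 k0 nak.
have m1 : (1 < a + a)%N by move: a0; clear; lia.
have n0 : (0 < n)%N by move: nak a0 k0; clear; nia.
have c0 := catalan_gt0 R n0.
rewrite {3}/meanLIS ler_pdivlMr//.
pose sk := skeleton (a + a).
have Ha i : (a <= i)%N -> meanLIS a * catalan R i <= LISsum p i.
  move=> ai; rewrite LISsumE ?(leq_trans a0)// ler_wpM2r ?catalan_ge0// meanLIS_mono//.
  by rewrite a0.
have S1 := @LIS_skeleton_le R p p_ge0 p_le1 a (meanLIS a) a0 Ha n (fun=> 1)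
  (fun=> ler01).
have S2 : meanLIS k * tsum p n (fun t => lift (fun u => (k <= leaves u)%N%:R) (sk t)) <=
   tsum p n (fun t => lift (fun u => (LIS u)%:R * 1) (sk t)).
  rewrite !(@tsum_skeleton R p (a + a) n m1 n)// mulr_sumr; apply: ler_sum => K _.
  rewrite mulrA ler_wpM2r ?skeleton_ser_ge0//.
  have -> : tsum p K (fun u => (k <= leaves u)%N%:R) = (k <= K)%N%:R * catalan R K.
    by rewrite -(@tsum_one R p)// -tsumZ; apply: eq_tsum => t ->; rewrite mulr1.
  have -> : tsum p K (fun u => (LIS u)%:R * 1) = LISsum p K by rewrite tsumZr mulr1.
  case: leqP => kK; last by rewrite mul0r mulr0 LISsum_ge0.
  by rewrite mul1r LISsumE ?(leq_trans k0)// ler_wpM2r ?catalan_ge0// meanLIS_mono// k0.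
have S3 := skeleton_large_prob a0 k0 nak; clear nak.
apply: (@le_trans _ _ (meanLIS a * tsum p n (fun t => lift (fun u => (LIS u)%:R * 1) (sk t)))).
  have -> : meanLIS k * meanLIS a / 256 * catalan R n = meanLIS a * (meanLIS k * (catalan R n / 256)) by ring.
  rewrite ler_wpM2l ?meanLIS_ge0//; apply: le_trans S2.
  by rewrite ler_wpM2l ?meanLIS_ge0.
apply: (le_trans S1); apply: tsum_le => // t _.
by case: skeleton => [u|] /=; rewrite ?mulr1 ?mulr0.
Qed.

End Supermultiplicativity.

(** * Powers *)

Section Powers.
Variable R : realType.
Implicit Types (a b c s x y : R) (n : nat).

(** The bound exp z >= 1 + z at (1 - s) ln y and at - s ln y, averaged with weights s and 1 - s, so
    that the logarithms cancel. *)
Lemma powR_bernoulli s y : 0 <= s -> s <= 1 -> 0 < y -> y `^ s <= 1 + s * (y - 1).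
Proof.
move=> s0 s1 y0; rewrite /powR gt_eqF//; set L := ln y; set g := expR (s * L).
have g0 : 0 < g by apply: expR_gt0.
have E1 : expR ((1 - s) * L) = y / g.
  by rewrite mulrBl mul1r expRD expRN lnK.
have E2 : expR (- (s * L)) = 1 / g by rewrite expRN mul1r.
have H1 := expR_ge1Dx ((1 - s) * L); have H2 := expR_ge1Dx (- (s * L)).
rewrite E1 in H1; rewrite E2 in H2.
have H : 1 <= s * (y / g) + (1 - s) * (1 / g).
  have s1' : 0 <= 1 - s by rewrite subr_ge0.
  have := ler_wpM2l s0 H1; have := ler_wpM2l s1' H2; clear; lra.
have -> : 1 + s * (y - 1) = g * (s * (y / g) + (1 - s) * (1 / g)).
  by field; rewrite gt_eqF.
by rewrite ler_peMr// ltW.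
Qed.

Lemma powRVl s y : 0 <= y -> y^-1 `^ s = (y `^ s)^-1.
Proof. by move=> y0; rewrite -powR_inv1// -powRrM mulN1r powRN. Qed.

Lemma gt0_powRD a b x : 0 < x -> x `^ (a + b) = x `^ a * x `^ b.
Proof. by move=> x0; rewrite powRD// (gt_eqF x0) implybT. Qed.

Lemma gt0_powRB a b x : 0 < x -> x `^ (a - b) = x `^ a / x `^ b.
Proof. by move=> x0; rewrite gt0_powRD// powRN. Qed.

Lemma powR_natr_unbounded a x : 0 < a ->
  exists2 N, (0 < N)%N & forall n, (N <= n)%N -> x <= n%:R `^ a.
Proof.
move=> a0; have y0 : 0 <= Num.max x 0 by rewrite le_max lexx orbT.
pose z := Num.max x 0 `^ a^-1.
exists (Num.bound z).+1 => // n Nn.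
have zn : z <= n%:R.
  apply: le_trans (ltW (archi_boundP (powR_ge0 _ _))) _.
  by rewrite ler_nat ltnW.
apply: (@le_trans _ _ (z `^ a)).
  by rewrite /z -powRrM mulVf ?gt_eqF// powRr1// le_max lexx.
by apply: (ge0_ler_powR (ltW a0)) => //; rewrite nnegrE ?powR_ge0.
Qed.

Lemma powR_exponent_le a b c x : 0 < c ->
  (forall n, (0 < n)%N -> c * n%:R `^ b <= x * n%:R `^ a) -> b <= a.
Proof.
move=> c0 H; rewrite leNgt; apply/negP => ab.
have ba0 : 0 < b - a by rewrite subr_gt0.
have [N N0 HN] := powR_natr_unbounded (x / c + 1) ba0.
have Nr : 0 < N%:R :> R by rewrite ltr0n.
have := H N N0; have := HN N (leqnn _); rewrite gt0_powRB//.
rewrite ler_pdivlMr ?powR_gt0// => H1 H2.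
have := ler_wpM2l (ltW c0) H1; rewrite mulrA mulrDr mulrCA divff ?gt_eqF// !mulr1.
have : 0 < c * N%:R `^ a by rewrite mulr_gt0// powR_gt0.
rewrite mulrDl => H3 H4; have := le_trans H4 H2.
by rewrite leNgt ltrDl H3.
Qed.

(** Of order n^(s + 1/2): the mean that corresponds to the sum [rising s]. *)
Definition rising_ratio s n := rising s n / catalan R n.

Lemma rising_ratioS s n : (0 < n)%N ->
  rising_ratio s n.+1 = rising_ratio s n * ((n%:R + s) / (n%:R - 1 / 2)).
Proof.
move=> n0; have nr : 1 <= n%:R :> R by rewrite ler1n.
have c0 := catalan_gt0 R n0; have c1 := catalan_gt0 R (ltn0Sn n).
have E1 := catalanSM R n0; have E2 := risingSM s n.
have n1 : n.+1%:R != 0 :> R by rewrite pnatr_eq0.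
have h0 : n%:R - 1 / 2 != 0 :> R by rewrite gt_eqF//; lra.
rewrite /rising_ratio.
have -> : rising s n.+1 = (s + n%:R) * rising s n / n.+1%:R.
  by rewrite -E2 mulrC mulKf.
have -> : catalan R n.+1 = (n%:R - 1 / 2) * catalan R n / n.+1%:R.
  by rewrite -E1 mulrC mulKf.
move: n1 h0 c0; set M := n.+1%:R; set u := n%:R - 1 / 2; set c := catalan R n.
by clearbody M u c => n1 h0 c0; field; rewrite n1 h0 gt_eqF.
Qed.

Lemma rising_ratio1 s : rising_ratio s 1 = 4 * s.
Proof. by rewrite /rising_ratio catalan1 risingS rising0; field. Qed.

Lemma rising_ratio_ge s n : 0 <= s -> s <= 1 / 2 -> (0 < n)%N ->
  4 * s * n%:R `^ (s + 1 / 2) <= rising_ratio s n.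
Proof.
move=> s0 s1; elim: n => // -[_ _|n IH _].
  by rewrite rising_ratio1 powR1 mulr1.
have nr : 1 <= n.+1%:R :> R by rewrite ler1n.
have n0 : 0 < n.+1%:R :> R by [].
rewrite rising_ratioS//.
have -> : n.+2%:R = n.+1%:R * (1 + n.+1%:R^-1) :> R.
  by rewrite mulrDr mulr1 divff ?gt_eqF// natr1.
have i0 : 0 <= n.+1%:R^-1 :> R by rewrite invr_ge0.
rewrite powRM// ?addr_ge0// mulrA; apply: ler_pM; rewrite ?powR_ge0//.
- by rewrite mulr_ge0 ?powR_ge0// mulr_ge0.
- exact: IH.
apply: le_trans (powR_bernoulli _ _ _) _; [lra..|by rewrite ltr_wpDr|].
move: nr n0 i0; set m := n.+1%:R; move=> nr n0 i0.
have -> : 1 + (s + 1 / 2) * (1 + m^-1 - 1) = (m + (s + 1 / 2)) / m.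
  by field; rewrite gt_eqF.
have h0 : 0 < m - 1 / 2 by lra.
rewrite ler_pdivrMr// mulrAC ler_pdivlMr//; nra.
Qed.

(** The induction compares with powers of 2n - 3, for which Bernoulli leaves a step factor 1 - ((s +
    1/2) / (n - 1/2))^2. It starts at [n = 2] with 8s (1 + s) <= 12s, and replacing 2n - 3 by n
    doubles the constant. *)
Lemma rising_ratio_le s n : 0 <= s -> s <= 1 / 2 -> (0 < n)%N ->
  rising_ratio s n <= 24 * s * n%:R `^ (s + 1 / 2).
Proof.
move=> s0 s1 n0.
have S0 : 0 <= s + 1 / 2 by lra.
have S1 : s + 1 / 2 <= 1 by lra.
have H k : rising_ratio s k.+2 <= 12 * s * (2 * k.+2%:R - 3) `^ (s + 1 / 2).
  elim: k => [|k IH].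
    rewrite rising_ratioS// rising_ratio1 (_ : 2 * 2 - 3 = 1); last by ring.
    rewrite powR1 mulr1 (_ : 1%:R - 1 / 2 = 2^-1); last by field.
    by rewrite invrK; nra.
  rewrite rising_ratioS//.
  have kr : 2 <= k.+2%:R :> R by rewrite ler_nat.
  rewrite -(natr1 k.+2); move: IH kr; set m := k.+2%:R => IH kr.
  have u0 : 0 < 2 * m - 3 by lra.
  have v0 : 0 < 2 * m - 1 by lra.
  have -> : 2 * (m + 1) - 3 = (2 * m - 3) * ((2 * m - 1) / (2 * m - 3)).
    by field; rewrite gt_eqF.
  have w0 : 0 < (2 * m - 1) / (2 * m - 3) by rewrite divr_gt0.
  rewrite powRM ?(ltW u0) ?(ltW w0)// mulrA; apply: ler_pM => //.
  - by rewrite /rising_ratio divr_ge0 ?catalan_ge0//; apply: prodr_ge0 => i _;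
      rewrite divr_ge0// addr_ge0.
  - by rewrite divr_ge0//; lra.
  have := powR_bernoulli S0 S1 (divr_gt0 u0 v0).
  have -> : (2 * m - 1) / (2 * m - 3) = ((2 * m - 3) / (2 * m - 1))^-1 by rewrite invf_div.
  have gp := powR_gt0 (s + 1 / 2) (divr_gt0 u0 v0).
  have h0 : 0 < m - 1 / 2 by lra.
  rewrite powRVl; last by rewrite divr_ge0 ?(ltW u0) ?(ltW v0).
  move: gp; set g := _ `^ _ => gp Hg.
  rewrite -[leRHS]mul1r ler_pdivlMr// mulrC.
  apply: (@le_trans _ _ ((1 + (s + 1 / 2) * ((2 * m - 3) / (2 * m - 1) - 1)) * ((m + s) / (m - 1 / 2)))).
    by rewrite ler_wpM2r// divr_ge0//; lra.
  have -> : (1 + (s + 1 / 2) * ((2 * m - 3) / (2 * m - 1) - 1)) * ((m + s) / (m - 1 / 2)) =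
    1 - ((s + 1 / 2) / (m - 1 / 2)) ^+ 2.
    by field; rewrite !gt_eqF//; lra.
  by rewrite gerBl sqr_ge0.
case: n n0 => // -[_|n _].
  by rewrite rising_ratio1 powR1; lra.
apply: (le_trans (H n)).
have nr : 2 <= n.+2%:R :> R by rewrite ler_nat.
have H2 : (2 * n.+2%:R - 3) `^ (s + 1 / 2) <= 2 * n.+2%:R `^ (s + 1 / 2).
  apply: (@le_trans _ _ ((2 * n.+2%:R) `^ (s + 1 / 2))).
    by apply: ge0_ler_powR; rewrite // ?nnegrE; lra.
  by rewrite powRM// ler_wpM2r ?powR_ge0// ler1_powR//; lra.
by have := ler_wpM2l s0 H2; lra.
Qed.

End Powers.

(** * The exponent *)

Section Fekete.
Variable R : realType.

(** The exponent is the supremum of the [E a] with [f a / D = (K a)^(E a)], so the upper bound holds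
    at every [n]. For the lower bound, a nearly optimal [a] is iterated along the powers of [K a],
    and monotonicity fills the gaps; [eps <= alpha] keeps the power function nondecreasing. *)
Lemma fekete_exponent (f : nat -> R) (K : nat) (D : R) : (1 < K)%N -> 1 <= D ->
  (forall n, (0 < n)%N -> 1 <= f n) -> (forall n, (0 < n)%N -> f n <= n%:R) ->
  (forall m n, (0 < m <= n)%N -> f m <= f n) ->
  (forall a k n, (0 < a)%N -> (0 < k)%N -> (K * a * k <= n)%N -> f k * f a / D <= f n) ->
  exists alpha B : R, [/\ 0 < B, forall n, (0 < n)%N -> f n <= B * n%:R `^ alpha &
    forall eps, 0 < eps -> eps <= alpha ->
      exists2 c : R, 0 < c & forall n, (0 < n)%N -> c * n%:R `^ (alpha - eps) <= f n].
Proof.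
move=> K1 D1 f1 fn fm fs.
have D0 : 0 < D by exact: lt_le_trans D1.
have f0 n : (0 < n)%N -> 0 < f n by move=> n0; apply: lt_le_trans (f1 n n0).
have Ka1 a : (0 < a)%N -> (1 < K * a)%N by move=> a0; rewrite (leq_trans K1)// leq_pmulr.
have KaR a : (0 < a)%N -> 0 < (K * a)%:R :> R by move=> a0; rewrite ltr0n ltnW ?Ka1.
have lnK0 a : (0 < a)%N -> 0 < ln (K * a)%:R :> R by move=> a0; rewrite ln_gt0// ltr1n Ka1.
pose E a := ln (f a / D) / ln (K * a)%:R.
pose A := [set x | exists2 a, (0 < a)%N & x = E a]%classic.
have E1 a : (0 < a)%N -> E a <= 1.
  move=> a0; rewrite /E ler_pdivrMr ?lnK0// mul1r ler_ln ?posrE ?KaR ?divr_gt0 ?f0//.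
  rewrite ler_pdivrMr//; apply: (le_trans (fn a a0)).
  apply: (@le_trans _ _ (K * a)%:R); first by rewrite ler_nat leq_pmull// ltnW.
  by rewrite ler_peMr.
have supA : has_sup A.
  split; first by exists (E 1%N), 1%N.
  by exists 1 => _ [a a0 ->]; exact: E1.
exists (sup A), (D * K%:R `^ sup A); split.
- by rewrite mulr_gt0// powR_gt0// ltr0n ltnW.
- move=> n n0; rewrite -mulrA -powRM// -natrM -ler_pdivrMl// mulrC.
  have : E n <= sup A by apply: ub_le_sup; [case: supA|exists n].
  rewrite /E ler_pdivrMr ?lnK0// -ln_powR ler_ln ?posrE ?powR_gt0 ?KaR ?divr_gt0 ?f0//.
move=> eps eps0 epsA; set s := sup A - eps.
have s0 : 0 <= s by rewrite /s subr_ge0.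
have [_ [a a0 ->] Ea] : exists2 x, A x & s < x by exact: sup_adherent.
pose X := (K * a)%N; have X1 : (1 < X)%N := Ka1 a a0.
have X0 : (0 < X)%N := ltnW X1.
have fa : X%:R `^ s <= f a / D.
  move: Ea; rewrite /E ltr_pdivlMr ?lnK0// => /ltW.
  by rewrite -ln_powR ler_ln ?posrE ?powR_gt0 ?KaR ?divr_gt0 ?f0.
have fX j : (X ^ j)%:R `^ s <= f (X ^ j)%N.
  elim: j => [|j IH]; first by rewrite expn0 powR1 f1.
  have Xj : (0 < X ^ j)%N by rewrite expn_gt0 X0.
  rewrite expnS natrM powRM//.
  apply: (le_trans _ (fs a (X ^ j)%N (X * X ^ j)%N a0 Xj (leqnn _))).
  by rewrite -mulrA mulrC ler_pM ?powR_ge0.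
have Xr : 0 < X%:R :> R by rewrite ltr0n.
exists (X%:R `^ s)^-1; first by rewrite invr_gt0 powR_gt0.
move=> n n0; have /andP[ln1 ln2] := trunc_log_bounds X1 n0.
set j := trunc_log X n in ln1 ln2.
have Xj : (0 < X ^ j)%N by rewrite expn_gt0 X0.
apply: (le_trans _ (fm (X ^ j)%N n _)); last by rewrite Xj.
apply: (le_trans _ (fX j)).
rewrite mulrC ler_pdivrMr ?powR_gt0// -powRM//.
apply: (ge0_ler_powR s0); rewrite ?nnegrE ?mulr_ge0//.
by rewrite -natrM ler_nat mulnC -expnS ltnW.
Qed.

End Fekete.

Section MeanGrowth.
Variables (R : realType) (p : R).
Hypotheses (p_gt0 : 0 < p) (p_lt1 : p < 1).

Let p_ge0 : 0 <= p := ltW p_gt0.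
Let p_le1 : p <= 1 := ltW p_lt1.

Local Notation f := (meanLIS p).

Lemma meanLIS_ge1 n : (0 < n)%N -> 1 <= f n.
Proof.
move=> n0; apply: le_trans (meanLIS_mono p_ge0 p_le1 (_ : (0 < 1 <= n)%N)); last by [].
by rewrite /meanLIS LISsum1 catalan1 divff.
Qed.

Lemma meanLIS_le n : (0 < n)%N -> f n <= n%:R.
Proof.
move=> n0; rewrite /meanLIS ler_pdivrMr ?catalan_gt0// -(@tsum_one R p)// -tsumZ.
by apply: tsum_le => // t <-; rewrite mulr1 ler_nat LIS_le_leaves.
Qed.

Lemma meanLIS_upper : exists B b : R, [/\ 0 < B, b < 1 &
  forall n, (0 < n)%N -> f n <= B * n%:R `^ b].
Proof.
have [s [x [s0 s1 x0 H]]] := LISsum_growth p_ge0 p_le1 p_lt1.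
exists (x * (24 * s)), (s + 1 / 2); split; [by rewrite !mulr_gt0|lra|] => n n0.
have c0 := catalan_gt0 R n0.
apply: (@le_trans _ _ (x * rising_ratio s n)).
  by rewrite /meanLIS /rising_ratio mulrA ler_wpM2r ?H// invr_ge0 ltW.
by rewrite -mulrA ler_wpM2l ?(ltW x0)// rising_ratio_le ?(ltW s0)// ltW.
Qed.

Lemma meanLIS_lower n : (0 < n)%N -> p / 3 * n%:R `^ (p / 2 + 1 / 2) <= f n.
Proof.
move=> n0; have c0 := catalan_gt0 R n0.
apply: (@le_trans _ _ (6^-1 * rising_ratio (p / 2) n)).
  have := @rising_ratio_ge R (p / 2) n _ _ n0.
  rewrite divr_ge0// => /(_ isT) H.
  have p2 : p / 2 <= 1 / 2 by rewrite ler_pM2r.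
  by have := H p2; set y := _ `^ _; lra.
rewrite /meanLIS /rising_ratio mulrA ler_wpM2r ?invr_ge0 ?(ltW c0)//.
exact: LISsum_ge.
Qed.

Lemma meanLIS_exponent : exists alpha B : R, [/\ 1 / 2 < alpha, alpha < 1, 0 < B,
  forall n, (0 < n)%N -> f n <= B * n%:R `^ alpha &
  forall eps, 0 < eps -> eps <= alpha ->
    exists2 c : R, 0 < c & forall n, (0 < n)%N -> c * n%:R `^ (alpha - eps) <= f n].
Proof.
have [//|//|||||alpha [B [B0 HB Hc]]] := @fekete_exponent R f 512 256.
- by rewrite ler1n.
- exact: meanLIS_ge1.
- exact: meanLIS_le.
- by move=> m n; exact: meanLIS_mono.
- by move=> a k n a0 k0 nak; exact: meanLIS_supermul nak.
have a1 : p / 2 + 1 / 2 <= alpha.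
  apply: (@powR_exponent_le _ _ _ (p / 3) B); first by rewrite divr_gt0.
  by move=> n n0; apply: le_trans (meanLIS_lower n0) (HB n n0).
have pp : 0 < p / 2 by rewrite divr_gt0.
exists alpha, B; split=> //; first by lra.
have [B' [b [B'0 b1 Hb]]] := meanLIS_upper.
rewrite ltNge; apply/negP => a2.
have e0 : 0 < (alpha - b) / 2 by lra.
have b0 : 0 <= b.
  by apply: (@powR_exponent_le _ _ _ 1 B') => // n n0; rewrite powRr0 mulr1 (le_trans _ (Hb n n0))// meanLIS_ge1.
have [|c c0 H] := Hc _ e0; first by lra.
have : alpha - (alpha - b) / 2 <= b.
  by apply: (@powR_exponent_le _ _ _ c B') => // n n0; apply: le_trans (H n n0) (Hb n n0).
lra.
Qed.

Lemma second_moment_le (alpha B : R) : 1 / 2 < alpha -> alpha < 1 -> 0 < B ->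
  (forall n, (0 < n)%N -> f n <= B * n%:R `^ alpha) ->
  exists2 C : R, 0 < C & forall n, (0 < n)%N ->
    LISsqsum p n / catalan R n <= C * n%:R `^ (2 * alpha).
Proof.
move=> a1 a2 B0 HB; pose s := alpha - 1 / 2.
have s0 : 0 < s by rewrite /s; lra.
have s1 : s <= 1 / 2 by rewrite /s; lra.
have sE : s + 1 / 2 = alpha by rewrite /s; lra.
have x0 : 0 <= B / (4 * s) by rewrite divr_ge0 ?(ltW B0)// mulr_ge0 ?(ltW s0).
have [|C C0 HC] := @LISsqsum_growth R p p_ge0 p_le1 s (B / (4 * s)) s0 x0.
  case=> [|n]; first by rewrite /LISsum tsum0 mulr_ge0// ltW// rising_gt0.
  have c0 := catalan_gt0 R (ltn0Sn n).
  have -> : rising s n.+1 = rising_ratio s n.+1 * catalan R n.+1 by rewrite /rising_ratio divfK// gt_eqF.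
  rewrite LISsumE// mulrA ler_wpM2r ?(ltW c0)//.
  have := rising_ratio_ge (ltW s0) s1 (ltn0Sn n); rewrite sE => H.
  apply: (le_trans (HB n.+1 isT)).
  by rewrite mulrAC ler_pdivlMr ?mulr_gt0// -mulrA ler_wpM2l ?(ltW B0)// mulrC.
exists (C * (24 * s) ^+ 2); first by rewrite mulr_gt0// exprn_gt0// mulr_gt0.
move=> n n0; have c0 := catalan_gt0 R n0.
have H := rising_ratio_le (ltW s0) s1 n0; rewrite sE in H.
have -> : n%:R `^ (2 * alpha) = (n%:R `^ alpha) ^+ 2 :> R.
  by rewrite mulrC powRrM powR_mulrn ?powR_ge0.
rewrite -[leRHS]mulrA -[X in _ <= _ * X]exprMn.
apply: (@le_trans _ _ (C * rising_ratio s n ^+ 2)).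
  have -> : LISsqsum p n / catalan R n = catalan R n * LISsqsum p n / catalan R n ^+ 2.
    by field; rewrite gt_eqF.
  by rewrite /rising_ratio expr_div_n [leRHS]mulrA ler_wpM2r// invr_ge0 sqr_ge0.
rewrite ler_wpM2l ?(ltW C0)// ler_sqr ?nnegrE//.
  by rewrite /rising_ratio divr_ge0 ?ltW// rising_gt0.
by rewrite mulr_ge0 ?powR_ge0// mulr_ge0// ltW.
Qed.

Lemma LISsqsum_gt0 n : (0 < n)%N -> 0 < LISsqsum p n.
Proof.
move=> n0; apply: (lt_le_trans (catalan_gt0 R n0)).
rewrite -(@tsum_one R p)//; apply: tsum_le => // t _.
by rewrite exprn_ege1// ler1n LIS_gt0.
Qed.

(** Cauchy-Schwarz is replaced by the pointwise bound y <= x/2 + lam y^2 / 2 + 1{y >= x/2} / (2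
    lam). With x the mean, A the second moment and lam = x / (2A), averaging gives x/4 <= (A/x)
    times the probability. *)
Lemma paley_zygmund n : (0 < n)%N ->
  f n ^+ 2 / (4 * (LISsqsum p n / catalan R n)) * catalan R n
    <= tsum p n (fun t => (f n / 2 <= (LIS t)%:R)%R%:R).
Proof.
move=> n0; have c0 := catalan_gt0 R n0; have f1 := meanLIS_ge1 n0.
set Q := tsum _ _ _; set A := LISsqsum p n / catalan R n.
have A0 : 0 < A by exact: divr_gt0 (LISsqsum_gt0 n0) c0.
pose x := f n; pose lam := x / (2 * A).
have x0 : 0 < x by exact: lt_le_trans f1.
have lam0 : 0 < lam by rewrite divr_gt0// mulr_gt0.
have H : LISsum p n <= tsum p n (fun t => (x / 2 * 1 + lam / 2 * (LIS t)%:R ^+ 2)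
    + (2 * lam)^-1 * (x / 2 <= (LIS t)%:R)%R%:R).
  apply: tsum_le => // t _; set y := (LIS t)%:R.
  have y0 : 0 <= y :> R by exact: ler0n.
  have q0 : 0 <= lam / 2 * y ^+ 2 by rewrite mulr_ge0 ?sqr_ge0// divr_ge0// ltW.
  case: (leP (x / 2) y) => xy /=; last by rewrite ?mulr0n mulr0 addr0; lra.
  rewrite ?mulr1n !mulr1.
  have : 0 <= lam / 2 * (y - lam^-1) ^+ 2 by rewrite mulr_ge0 ?sqr_ge0// divr_ge0// ltW.
  have -> : lam / 2 * (y - lam^-1) ^+ 2 = lam / 2 * y ^+ 2 - y + (2 * lam)^-1.
    by field; rewrite gt_eqF.
  by lra.
rewrite !tsumD !tsumZ tsum_one// -/(LISsqsum p n) -/Q in H.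
have EA : LISsqsum p n = A * catalan R n by rewrite /A divfK// gt_eqF.
have ES : LISsum p n = x * catalan R n by rewrite /x /meanLIS divfK// gt_eqF.
rewrite EA ES in H.
have E1 : lam / 2 * (A * catalan R n) = x / 4 * catalan R n.
  by rewrite /lam; field; rewrite gt_eqF.
have E2 : (2 * lam)^-1 = A / x.
  by rewrite /lam; field; rewrite !gt_eqF.
rewrite E1 E2 in H.
have H' : x / 4 * catalan R n <= A / x * Q by move: H; clear; lra.
have -> : x ^+ 2 / (4 * A) * catalan R n = x / A * (x / 4 * catalan R n).
  by field; rewrite gt_eqF.
apply: (@le_trans _ _ (x / A * (A / x * Q))).
  by rewrite ler_wpM2l// divr_ge0// ltW.
by rewrite mulrA (_ : x / A * (A / x) = 1) ?mul1r//; field; rewrite !gt_eqF.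
Qed.

End MeanGrowth.

(** * Concentration *)

Section Tails.
Variables (R : realType) (p : R).
Hypotheses (p_gt0 : 0 < p) (p_lt1 : p < 1).

Let p_ge0 : 0 <= p := ltW p_gt0.
Let p_le1 : p <= 1 := ltW p_lt1.

Local Notation f := (meanLIS p).

Lemma expR_half_le (y : R) n : 0 <= y -> y <= 1 -> expR (n%:R * (y / 2)) <= (1 + y) ^+ n.
Proof.
move=> y0 y1; rewrite expRM_natl lerXn2r ?nnegrE ?expR_ge0 ?addr_ge0//.
have H := expR_ge1Dx (- (y / 2)); rewrite expRN in H.
have e0 := expR_gt0 (y / 2).
have H' : (1 - y / 2) * expR (y / 2) <= 1 by rewrite -ler_pdivlMr// mul1r.
have h : 1 / 2 <= 1 - y / 2 by lra.
rewrite -(ler_pM2l (_ : 0 < 1 - y / 2)); last by lra.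
by apply: (le_trans H'); nra.
Qed.

(** The exponent is 1 - (1 - 3 eps)(1 + 2 eps) = eps + 6 eps^2 >= eps: about n/m trials against a
    success probability of order m^(-2 eps). *)
Lemma trials_bound (rho eps : R) n m : 0 < eps -> eps <= 1 / 8 ->
  0 < rho -> (0 < m)%N -> (0 < n)%N -> m%:R <= n%:R `^ (1 - 3 * eps) ->
  rho / 128 * n%:R `^ eps <= n%:R * (rho * m%:R `^ (- (2 * eps)) / (128 * m%:R)).
Proof.
move=> e0 e1 rho0 m0 n0 mn.
have mr : 0 < m%:R :> R by rewrite ltr0n.
have nr : 1 <= n%:R :> R by rewrite ler1n.
have nr0 : 0 < n%:R :> R by rewrite ltr0n.
have -> : n%:R * (rho * m%:R `^ (- (2 * eps)) / (128 * m%:R)) =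
  rho / 128 * (n%:R * (m%:R `^ (1 + 2 * eps))^-1).
  have -> : m%:R `^ (1 + 2 * eps) = m%:R * m%:R `^ (2 * eps) :> R.
    by rewrite gt0_powRD// powRr1// ltW.
  rewrite powRN; field.
  by rewrite !gt_eqF ?powR_gt0.
rewrite ler_wpM2l ?divr_ge0 ?(ltW rho0)// ler_pdivlMr ?powR_gt0//.
apply: (@le_trans _ _ (n%:R `^ eps * n%:R `^ ((1 - 3 * eps) * (1 + 2 * eps)))).
  rewrite ler_wpM2l ?powR_ge0// powRrM.
  by apply: ge0_ler_powR; rewrite ?nnegrE ?powR_ge0//; lra.
rewrite -gt0_powRD// -[leRHS](powRr1 (ltW nr0)) ler_powR//; nra.
Qed.

Lemma trial_prob (alpha C c eps : R) : 0 < c -> 0 < C ->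
  (forall n, (0 < n)%N -> c * n%:R `^ (alpha - eps) <= f n) ->
  (forall n, (0 < n)%N -> LISsqsum p n / catalan R n <= C * n%:R `^ (2 * alpha)) ->
  forall n, (0 < n)%N -> c ^+ 2 / (4 * C) * n%:R `^ (- (2 * eps)) * catalan R n
    <= tsum p n (fun t => (f n / 2 <= (LIS t)%:R)%R%:R).
Proof.
move=> c0 C0 Hc HC n n0.
apply: le_trans (paley_zygmund p_gt0 p_lt1 n0).
have nr : 0 < n%:R :> R by rewrite ltr0n.
have cn := catalan_gt0 R n0.
have na := powR_gt0 alpha nr; have ne := powR_gt0 eps nr.
rewrite ler_wpM2r ?(ltW cn)//.
have f1 := meanLIS_ge1 p_gt0 p_lt1 n0.
set A := LISsqsum p n / catalan R n.
have A0 : 0 < A by exact: divr_gt0 (LISsqsum_gt0 p_gt0 p_lt1 n0) cn.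
have A4 : 0 < 4 * A by exact: mulr_gt0.
rewrite ler_pdivlMr//.
have HA : A <= C * (n%:R `^ alpha) ^+ 2.
  by apply: (le_trans (HC n n0)); rewrite [2 * alpha]mulrC powRrM powR_mulrn ?powR_ge0.
have Hf : (c * (n%:R `^ alpha / n%:R `^ eps)) ^+ 2 <= f n ^+ 2.
  rewrite ler_sqr ?nnegrE; [|by rewrite mulr_ge0 ?divr_ge0 ?(ltW c0) ?powR_ge0|by rewrite (le_trans _ f1)].
  by apply: le_trans (Hc n n0); rewrite gt0_powRB.
apply: (le_trans _ Hf).
rewrite powRN [2 * eps]mulrC powRrM powR_mulrn ?powR_ge0//.
move: na ne HA; set u := _ `^ alpha; set v := _ `^ eps => na ne HA.
have -> : (c * (u / v)) ^+ 2 = c ^+ 2 / (4 * C) / v ^+ 2 * (4 * (C * u ^+ 2)).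
  by field; rewrite !gt_eqF.
rewrite ler_wpM2l//; last by rewrite ler_pM2l.
by rewrite mulr_ge0 ?invr_ge0 ?sqr_ge0// divr_ge0 ?sqr_ge0// mulr_ge0// ltW.
Qed.

Lemma miss_prob (rho eps : R) : 0 < eps -> eps <= 1 / 8 -> 0 < rho -> rho <= 1 ->
  (forall m, (0 < m)%N -> rho * m%:R `^ (- (2 * eps)) * catalan R m
    <= tsum p m (fun t => (f m / 2 <= (LIS t)%:R)%R%:R)) ->
  exists2 C : R, 0 < C & forall n m, (0 < n)%N -> (0 < m)%N ->
    m%:R <= n%:R `^ (1 - 3 * eps) ->
    tsum p n (fun t => (~~ (f m / 2 <= (LIS t)%:R))%:R) <= C / n%:R * catalan R n.
Proof.
move=> e0 e1 rho0 rho1 Hrho.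
(* The Taylor term of order [K + 1] of the exponential is at least of order n^3, which beats the n^2
   of [amplification] and leaves 1/n. *)
pose K := Num.bound (3 / eps).
have Ke : 3 <= eps * K.+1%:R.
  rewrite mulrC -ler_pdivrMr//; apply: (le_trans (ltW (archi_boundP _))).
    by rewrite divr_ge0// ltW.
  by rewrite ler_nat.
pose kappa := (rho / 256) ^+ K.+1 / (K.+1)`!%:R.
have rho256 : 0 < rho / 256 := divr_gt0 rho0 (ltr0Sn R 255).
have k0 : 0 < kappa.
  by apply: divr_gt0; [exact: exprn_gt0|rewrite ltr0n fact_gt0].
exists (4 / kappa); first by rewrite divr_gt0.
move=> n m n0 m0 mn.
have mr : 1 <= m%:R :> R by rewrite ler1n.
have nr : 1 <= n%:R :> R by rewrite ler1n.
have nr0 : 0 < n%:R :> R by rewrite ltr0n.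
have cn := catalan_gt0 R n0; have cm := catalan_gt0 R m0.
pose r := rho * m%:R `^ (- (2 * eps)).
have m1 : m%:R `^ (- (2 * eps)) <= 1 :> R.
  rewrite powRN invf_le1; last by rewrite powR_gt0// ltr0n.
  by rewrite -[leLHS](powRr0 m%:R) ler_powR//; lra.
have r0 : 0 < r by rewrite mulr_gt0 ?powR_gt0// ltr0n.
have r1 : r <= 1.
  by rewrite /r -[leRHS]mulr1; apply: ler_pM; rewrite ?powR_ge0 ?(ltW rho0).
pose P t := f m / 2 <= (LIS t)%:R.
have Ph s t1 t2 : P t1 || P t2 -> P (Node s t1 t2).
  have := LIS_node_maxn s t1 t2; rewrite geq_max => /andP[H1 H2].
  by case/orP => H; apply: (le_trans H); rewrite ler_nat.
(* Monotonicity of the tail in the size extends the estimate from [m] to the whole window. *)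
have Pw i : (m <= i < m + m)%N -> r * catalan R i <= tsum p i (fun t => (P t)%:R).
  case/andP=> mi _; have ci := catalan_gt0 R (leq_trans m0 mi).
  rewrite -ler_pdivlMr//.
  apply: le_trans (@tsum_LIS_mono R p p_ge0 p_le1
    (fun k => (f m / 2 <= k%:R)%R%:R) m i _ _ _); last 3 first.
  - by move=> k; rewrite ler0n.
  - by move=> k l kl; rewrite ler_nat; case: leP => // H;
      rewrite (le_trans H) ?ler_nat.
  - by rewrite m0.
  by rewrite ler_pdivlMr// Hrho.
have := @amplification R p p_ge0 p_le1 P m r Ph m0 (ltW r0) r1 Pw n n0.
set y := r / (128 * m%:R); set Q := tsum _ _ _ => HQ.
have y0 : 0 <= y by rewrite divr_ge0 ?(ltW r0)// mulr_ge0.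
have y1 : y <= 1 by rewrite ler_pdivrMr; lra.
have Q0 : 0 <= Q by apply: tsum_ge0.
have z1 := trials_bound e0 e1 rho0 m0 n0 mn; rewrite -/r -/y in z1.
have z2 : rho / 256 * n%:R `^ eps <= n%:R * (y / 2) by move: z1; clear; lra.
have big : kappa * n%:R ^+ 3 <= (1 + y) ^+ n.
  apply: le_trans (expR_half_le n y0 y1).
  have z0 : 0 <= n%:R * (y / 2) by rewrite mulr_ge0// divr_ge0.
  apply: le_trans (expR_ge1Dxn K z0).
  apply: (@le_trans _ _ ((n%:R * (y / 2)) ^+ K.+1 / K.+1`!%:R)); last by rewrite lerDr.
  rewrite /kappa mulrAC ler_wpM2r ?invr_ge0//.
  apply: (@le_trans _ _ ((rho / 256 * n%:R `^ eps) ^+ K.+1)).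
    rewrite [leRHS]exprMn ler_wpM2l ?exprn_ge0 ?(ltW rho256)//.
    rewrite -powR_mulrn ?ler0n// -powR_mulrn ?powR_ge0// -powRrM ler_powR//.
  by rewrite lerXn2r// nnegrE; apply: mulr_ge0; rewrite ?powR_ge0 ?(ltW rho256).
have HQ' : Q * (kappa * n%:R ^+ 3) <= 4 * n%:R ^+ 2 * catalan R n.
  by apply: le_trans HQ; rewrite ler_wpM2l.
have n3 : 0 < kappa * n%:R ^+ 3 by rewrite mulr_gt0// exprn_gt0.
rewrite -(ler_pM2r n3); apply: (le_trans HQ').
rewrite le_eqVlt; apply/orP; left; apply/eqP.
by field; rewrite !gt_eqF.
Qed.

Lemma lower_tail (alpha B : R) : 1 / 2 < alpha -> alpha < 1 -> 0 < B ->
  (forall n, (0 < n)%N -> f n <= B * n%:R `^ alpha) ->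
  (forall eps, 0 < eps -> eps <= alpha ->
    exists2 c : R, 0 < c & forall n, (0 < n)%N -> c * n%:R `^ (alpha - eps) <= f n) ->
  forall delta, 0 < delta -> exists2 C : R, 0 < C & exists2 N, (0 < N)%N &
    forall n, (N <= n)%N ->
    tsum p n (fun t => ((LIS t)%:R < n%:R `^ (alpha - delta))%R%:R) <= C / n%:R * catalan R n.
Proof.
move=> a1 a2 B0 HB Hc delta d0.
(* As alpha < 1, (1 - 3 eps)(alpha - eps) >= alpha - 4 eps. Taking eps <= delta / 8 leaves the power
   n^(delta - 4 eps) to absorb 4/c, where one 2 is the halved mean and the other the rounding of
   [m]. *)
pose eps := Num.min (delta / 8) (1 / 8).
have e0 : 0 < eps by rewrite lt_min !divr_gt0.
have e1 : eps <= 1 / 8 by rewrite ge_min lexx orbT.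
have e2 : eps <= delta / 8 by rewrite ge_min lexx.
clearbody eps.
have [|c c0 Hce] := Hc eps e0; first by lra.
have [C2 C20 HC2] := second_moment_le p_gt0 p_lt1 a1 a2 B0 HB.
have Htp := trial_prob c0 C20 Hce HC2.
pose rho := Num.min 1 (c ^+ 2 / (4 * C2)).
have rho0 : 0 < rho by rewrite lt_min ltr01 divr_gt0 ?exprn_gt0// mulr_gt0.
have rho1 : rho <= 1 by rewrite ge_min lexx.
have rho2 : rho <= c ^+ 2 / (4 * C2) by rewrite ge_min lexx orbT.
clearbody rho.
have [|C C0 HC] := miss_prob e0 e1 rho0 rho1.
  move=> m m0; apply: le_trans (Htp m m0).
  by rewrite ler_wpM2r ?catalan_ge0// ler_wpM2r// powR_ge0.
exists C => //.
have d4 : 0 < delta - 4 * eps by lra.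
have [N N0 HN] := powR_natr_unbounded (4 / c) d4.
exists N => // n Nn; have n0 := leq_trans N0 Nn.
have nr : 1 <= n%:R :> R by rewrite ler1n.
have nr0 : 0 < n%:R :> R by rewrite ltr0n.
pose u : R := n%:R `^ (1 - 3 * eps).
have u1 : 1 <= u by rewrite -[leLHS](powRr0 n%:R) ler_powR//; lra.
have u0 : 0 <= u by lra.
pose m := Num.truncn u.
have /andP[mu um] := truncn_itv u0; rewrite -/m in mu um.
have m0 : (0 < m)%N by rewrite /m truncn_ge_nat.
have mr : 1 <= m%:R :> R by rewrite ler1n.
apply: (le_trans _ (HC n m n0 m0 mu)); apply: tsum_le => // t _.
case: ltP => // Lt /=.
suff -> : ~~ (f m / 2 <= (LIS t)%:R) by [].
rewrite -ltNge; apply: (lt_le_trans Lt).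
have um2 : u / 2 <= m%:R by rewrite -(natr1 m) in um; lra.
have ae : 0 <= alpha - eps by lra.
have H1 : (u / 2) `^ (alpha - eps) <= m%:R `^ (alpha - eps).
  by apply: (ge0_ler_powR ae) => //; rewrite nnegrE ?divr_ge0.
rewrite powRM ?invr_ge0// powRVl// in H1.
have H2 : (2 `^ (alpha - eps))^-1 >= 2^-1 :> R.
  by rewrite lef_pV2 ?posrE ?powR_gt0// ler1_powR ?ler1n//; lra.
have H3 : n%:R `^ (alpha - 4 * eps) <= u `^ (alpha - eps).
  by rewrite /u -powRrM ler_powR//; nra.
have H4 : n%:R `^ (alpha - 4 * eps) / 2 <= m%:R `^ (alpha - eps).
  by apply: le_trans H1; apply: ler_pM; rewrite ?powR_ge0.
have H5 := Hce m m0.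
have H6 : n%:R `^ (alpha - 4 * eps) = n%:R `^ (alpha - delta) * n%:R `^ (delta - 4 * eps) :> R.
  rewrite -gt0_powRD//; congr (_ `^ _); ring.
have H7 := HN n Nn; rewrite ler_pdivrMr// in H7.
have g0 : 0 <= n%:R `^ (alpha - delta) :> R by exact: powR_ge0.
have := ler_wpM2l (ltW c0) H4; rewrite H6.
have := ler_wpM2l g0 H7.
move: H5; set X := f m; set Y := _ `^ (alpha - eps); set V := _ `^ (alpha - delta).
set W := _ `^ (delta - _); clear; lra.
Qed.

Lemma upper_tail (alpha B eps : R) n : (0 < n)%N ->
  f n <= B * n%:R `^ alpha ->
  tsum p n (fun t => (n%:R `^ (alpha + eps) < (LIS t)%:R)%R%:R)
    <= B / n%:R `^ eps * catalan R n.
Proof.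
move=> n0 Hf; have nr : 0 < n%:R :> R by rewrite ltr0n.
have y0 := powR_gt0 (alpha + eps) nr.
apply: (@le_trans _ _ (LISsum p n / n%:R `^ (alpha + eps))).
  rewrite /LISsum -tsumZr; apply: tsum_le => // t _.
  rewrite ler_pdivlMr//; case: ltP => /= H; last by rewrite mul0r.
  by rewrite mul1r ltW.
rewrite LISsumE// mulrAC ler_wpM2r ?catalan_ge0// gt0_powRD//.
have := powR_gt0 alpha nr; have := powR_gt0 eps nr.
move: Hf; set F := f n; set u := _ `^ alpha; set v := _ `^ eps => Hf v0 u0.
rewrite ler_pdivrMr ?mulr_gt0//; apply: (le_trans Hf).
by rewrite mulrCA mulrC mulfVK// gt_eqF.
Qed.

Lemma ln_ratio_le (alpha delta x : R) n : (1 < n)%N -> 0 < x ->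
  n%:R `^ (alpha - delta) <= x -> x <= n%:R `^ (alpha + delta) ->
  `|ln x / ln n%:R - alpha| <= delta.
Proof.
move=> n1 x0 H1 H2.
have nr : 0 < n%:R :> R by rewrite ltr0n ltnW.
have l0 : 0 < ln n%:R :> R by rewrite ln_gt0// ltr1n.
have L1 : (alpha - delta) * ln n%:R <= ln x.
  by rewrite -ln_powR ler_ln ?posrE ?powR_gt0.
have L2 : ln x <= (alpha + delta) * ln n%:R.
  by rewrite -ln_powR ler_ln ?posrE ?powR_gt0.
have L1' : alpha - delta <= ln x / ln n%:R by rewrite ler_pdivlMr.
have L2' : ln x / ln n%:R <= alpha + delta by rewrite ler_pdivrMr.
by rewrite ler_norml; apply/andP; split; lra.
Qed.

Lemma ExpT_tsum n (X : stree -> R) : ExpT p n X = tsum p n X / catalan R n.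
Proof.
rewrite -(@tsum_one R p)// /ExpT /tsum; under [X in _ = _ / (_ * X)]eq_bigr do rewrite mulr1.
by rewrite invfM mulrACA divff ?mul1r// expf_neq0// invr_neq0.
Qed.

Lemma ProbT_tsum n (A : stree -> bool) :
  ProbT p n A = tsum p n (fun t => (A t)%:R) / catalan R n.
Proof.
rewrite -ExpT_tsum /ProbT /ExpT; congr (_ / _); rewrite big_mkcond.
by apply: eq_bigr => t _; case: (A t); rewrite ?mulr1 ?mulr0.
Qed.

End Tails.

(** * Convergence in probability and the limit for the mean *)

Local Open Scope classical_set_scope.
Local Open Scope ring_scope.

Theorem theorem2p1 (R : realType) (p : R) (hp0 : 0 < p) (hp1 : p < 1) :
  exists alpha : R, [/\ 1 / 2 < alpha, alpha < 1,
    (forall eps : R, 0 < eps ->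
       (fun n : nat => ProbT p n
          (fun t => eps < `| ln (LIS t)%:R / ln n%:R - alpha |)) @ \oo --> 0)
  & limn_esup (fun n : nat => (ln (ExpT p n (fun t => (LIS t)%:R)) / ln n%:R)%:E)
      = alpha%:E].
Proof.
have [alpha [B [a1 a2 B0 HB Hc]]] := meanLIS_exponent hp0 hp1.
exists alpha; split=> // [eps eps0|].
- have [C C0 [N1 N10 HL]] := lower_tail hp0 hp1 a1 a2 B0 HB Hc eps0.
  apply/cvgrPdist_le => e e0.
  have [N2 N20 H2] := powR_natr_unbounded (2 * C / e) (@ltr01 R).
  have [N3 N30 H3] := powR_natr_unbounded (2 * B / e) eps0.
  exists (N1 + N2 + N3).+2 => // n /= Nn.
  have n1 : (1 < n)%N by exact: leq_trans Nn.
  have n0 : (0 < n)%N by exact: ltnW.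
  have NN1 : (N1 <= n)%N by apply: leq_trans Nn; rewrite -!addnA ltnW// ltnW// !ltnS leq_addr.
  have NN2 : (N2 <= n)%N.
    by apply: leq_trans Nn; rewrite ltnW// ltnW// !ltnS addnAC leq_addl.
  have NN3 : (N3 <= n)%N by apply: leq_trans Nn; rewrite ltnW// ltnW// !ltnS leq_addl.
  have nr : 0 < n%:R :> R by rewrite ltr0n.
  have c0 := catalan_gt0 R n0.
  have p0 := ltW hp0; have p1 := ltW hp1.
  have P0 A : 0 <= ProbT p n A.
    by rewrite ProbT_tsum divr_ge0 ?(ltW c0)//; apply: tsum_ge0.
  rewrite sub0r normrN ger0_norm// ProbT_tsum ler_pdivrMr//.
  apply: (@le_trans _ _ (C / n%:R * catalan R n + B / n%:R `^ eps * catalan R n)); last first.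
    rewrite -mulrDl ler_wpM2r ?(ltW c0)//.
    have := H2 n NN2; rewrite powRr1 ?(ltW nr)// => H2n.
    have := H3 n NN3 => H3n.
    have v0 := powR_gt0 eps nr.
    have K1 : C / n%:R <= e / 2.
      rewrite ler_pdivrMr//; rewrite ler_pdivrMr// in H2n; lra.
    have K2 : B / n%:R `^ eps <= e / 2.
      rewrite ler_pdivrMr//; rewrite ler_pdivrMr// in H3n; lra.
    lra.
  apply: (le_trans _ (lerD (HL n NN1) (upper_tail hp0 hp1 eps n0 (HB n n0)))).
  rewrite -tsumD; apply: tsum_le => // t _.
  have L0 : 0 < (LIS t)%:R :> R by rewrite ltr0n LIS_gt0.
  (* The deviation event is contained in the union of the two tails. *)
  have [lo|lo] := ltP (LIS t)%:R (n%:R `^ (alpha - eps)).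
    by rewrite -natrD ler_nat; case: (_ < _).
  have [up|up] := ltP (n%:R `^ (alpha + eps)) (LIS t)%:R.
    by rewrite -natrD ler_nat; case: (_ < _).
  by rewrite ltNge (ln_ratio_le n1 L0 lo up) /= addr0.
(* The sequence even converges, and its terms are finite, so the limit is taken in [R]. *)
- apply: (cvg_limn_einf_sup _).2; apply/fine_cvgP; split; first exact: nearW.
  apply/cvgrPdist_le => e e0.
  pose d := Num.min (e / 2) alpha.
  have d0 : 0 < d by rewrite lt_min divr_gt0//; lra.
  have d1 : d <= alpha by rewrite ge_min lexx orbT.
  have d2 : d <= e / 2 by rewrite ge_min lexx.
  clearbody d.
  have [c c0 Hd] := Hc d d0 d1.
  have ed : 0 < e - d by lra.
  have [N2 N20 H2] := powR_natr_unbounded c^-1 ed.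
  have [N3 N30 H3] := powR_natr_unbounded B e0.
  exists (N2 + N3).+2 => // n /= Nn.
  have n1 : (1 < n)%N by exact: leq_trans Nn.
  have n0 : (0 < n)%N by exact: ltnW.
  have NN2 : (N2 <= n)%N by apply: leq_trans Nn; rewrite ltnW// ltnW// !ltnS leq_addr.
  have NN3 : (N3 <= n)%N by apply: leq_trans Nn; rewrite ltnW// ltnW// !ltnS leq_addl.
  have nr : 0 < n%:R :> R by rewrite ltr0n.
  rewrite /= ExpT_tsum -/(LISsum p n) -/(meanLIS p n) distrC.
  apply: ln_ratio_le => //.
  + exact: lt_le_trans (meanLIS_ge1 hp0 hp1 n0).
  + apply: le_trans (Hd n n0).
    have -> : alpha - d = (alpha - e) + (e - d) by ring.
    rewrite (@gt0_powRD _ (alpha - e))// mulrCA ler_peMr ?powR_ge0//.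
    by rewrite -[leLHS](mulfV (lt0r_neq0 c0)) ler_pM2l// H2.
  + apply: (le_trans (HB n n0)); rewrite gt0_powRD// mulrC ler_wpM2l ?powR_ge0//.
    exact: H3.
Qed.
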